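(* Let $a\geq 0$ and $b\in\mathbb{R}$, $b\neq 0$, be constants, and let $f_{m}\in L^{2}(\mathbb{R})$, $m\in\mathbb{N}$, be such that $f_{m}\to f$ in $L^{2}(\mathbb{R})$ as $m\to\infty$. Consider the equations $$-\frac{d^{2}u}{dx^{2}}+\frac{d^{4}u}{dx^{4}}-b\frac{du}{dx}-au=f(x),\quad x\in\mathbb{R}, \qquad (\ast)$$ $$-\frac{d^{2}u_{m}}{dx^{2}}+\frac{d^{4}u_{m}}{dx^{4}}-b\frac{du_{m}}{dx}-au_{m}=f_{m}(x),\quad x\in\mathbb{R},\ m\in\mathbb{N}. \qquad (\ast_{m})$$ a) If $a>0$, then $(\ast)$ and $(\ast_{m})$ possess unique solutions $u\in H^{4}(\mathbb{R})$ and $u_{m}\in H^{4}(\mathbb{R})$ respectively, and $u_{m}\to u$ in $H^{4}(\mathbb{R})$ as $m\to\infty$. b) If $a=0$, suppose that $xf_{m}(x)\in L^{1}(\mathbb{R})$ for all $m\in\mathbb{N}$, that $xf_{m}(x)\to xf(x)$ in $L^{1}(\mathbb{R})$ as $m\to\infty$, and that $(f_{m}(x),1)_{L^{2}(\mathbb{R})}=0$ for all $m\in\mathbb{N}$. Then $(\ast)$ and $(\ast_{m})$ have unique solutions $u\in H^{4}(\mathbb{R})$ and $u_{m}\in H^{4}(\mathbb{R})$ respectively, and $u_{m}\to u$ in $H^{4}(\mathbb{R})$ as $m\to\infty$.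
   Context: Functions are complex-valued. $H^{4}(\mathbb{R})$ is the usual Sobolev space, equipped with the norm $\|u\|_{H^{4}(\mathbb{R})}^{2}:=\|u\|_{L^{2}(\mathbb{R})}^{2}+\left\|\frac{d^{4}u}{dx^{4}}\right\|_{L^{2}(\mathbb{R})}^{2}$; the equations are understood as equalities in $L^{2}(\mathbb{R})$. The notation $(f,g)_{L^{2}(\mathbb{R})}:=\int_{-\infty}^{\infty}f(x)\overline{g(x)}\,dx$ is also used when $f\in L^{1}(\mathbb{R})$ and $g$ is bounded, so $(f_{m}(x),1)_{L^{2}(\mathbb{R})}=\int_{-\infty}^{\infty}f_{m}(x)\,dx$; this is well defined when $f_{m}\in L^{2}(\mathbb{R})$ and $xf_{m}(x)\in L^{1}(\mathbb{R})$, since then $f_{m}\in L^{1}(\mathbb{R})$. *)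

(* Defs.v *)
From HB Require Import structures.
From mathcomp Require Import all_boot all_order all_algebra.
From mathcomp Require Import complex.
From mathcomp Require Import all_classical all_reals all_analysis.

Set Implicit Arguments.
Unset Strict Implicit.
Unset Printing Implicit Defensive.

Import Order.TTheory GRing.Theory Num.Theory.
Import numFieldNormedType.Exports.

Local Open Scope classical_set_scope.
Local Open Scope ring_scope.

Section complex_Lp.
Context {R : realType}.
Implicit Types (f g : R -> R[i]) (p : \bar R).

Local Notation mu := (@lebesgue_measure R).

Definition cmeasurable f : Prop :=
  measurable_fun setT (@complex.Re R \o f) /\
  measurable_fun setT (@complex.Im R \o f).

Definition cLnorm p f : \bar R :=
  Lnorm mu p (fun x => (Normc.normc (f x))%:E).

(* Elements of L^p are represented by functions; identification almost
   everywhere is made explicit by [ae_equal]. *)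
Definition in_Lp p f : Prop := cmeasurable f /\ (cLnorm p f < +oo)%E.

Definition ae_equal f g : Prop := {ae mu, forall x, f x = g x}.

Definition cvg_in_Lp p (f_ : nat -> R -> R[i]) f : Prop :=
  [/\ forall m, in_Lp p (f_ m), in_Lp p f &
      (fun m => cLnorm p (fun x => f_ m x - f x)) @ \oo --> 0%E].

Definition cintegral f : R[i] :=
  Complex (\int[mu]_x @complex.Re R (f x)) (\int[mu]_x @complex.Im R (f x)).

Definition inner f g : R[i] := cintegral (fun x => f x * conjc (g x)).

End complex_Lp.

Section sobolev.
Context {R : realType}.
Implicit Types (f u v : R -> R[i]) (phi : R -> R) (k n : nat).

Local Notation mu := (@lebesgue_measure R).

Definition clocally_integrable u : Prop :=
  locally_integrable setT (@complex.Re R \o u) /\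
  locally_integrable setT (@complex.Im R \o u).

(* C_c^oo(R); real-valued test functions suffice to test complex-valued
   functions, since the pairing below is complex-linear. *)
Definition test_function phi : Prop :=
  (forall k x, derivable (derive1n k phi) x 1) /\
  compact (closure [set x | phi x != 0]).

Definition is_weak_derivative k u v : Prop :=
  [/\ clocally_integrable u, clocally_integrable v &
    forall phi, test_function phi ->
      cintegral (fun x => u x * real_complex R (derive1n k phi x)) =
      (-1) ^+ k * cintegral (fun x => v x * real_complex R (phi x))].

(* A weak derivative, when it exists, is unique only up to equality almost
   everywhere; [wderiv] selects a representative. *)
Definition wderiv k u : R -> R[i] :=
  xget (fun=> 0) [set v | is_weak_derivative k u v].

Definition sobolevH n u : Prop :=
  in_Lp 2%:E u /\
  forall k, (1 <= k <= n)%N ->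
    exists2 v, in_Lp 2%:E v & is_weak_derivative k u v.

Definition H4norm u : \bar R :=
  sqrte (cLnorm 2%:E u ^+ 2 + cLnorm 2%:E (wderiv 4 u) ^+ 2)%E.

Definition cvg_in_H4 (u_ : nat -> R -> R[i]) u : Prop :=
  [/\ forall m, sobolevH 4 (u_ m), sobolevH 4 u &
      (fun m => H4norm (fun x => u_ m x - u x)) @ \oo --> 0%E].

Definition solution (a b : R) f u : Prop :=
  sobolevH 4 u /\
  ae_equal (fun x => - wderiv 2 u x + wderiv 4 u x
                     - real_complex R b * wderiv 1 u x
                     - real_complex R a * u x) f.

Definition unique_solution (a b : R) f u : Prop :=
  solution a b f u /\ forall v, solution a b f v -> ae_equal v u.

End sobolev.

(* Main.v *)
Require Import Defs.
From HB Require Import structures.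
From mathcomp Require Import all_boot all_order all_algebra.
From mathcomp Require Import complex.
From mathcomp Require Import all_classical all_reals all_analysis.
From mathcomp Require Import measurable_realfun ring lra.

Set Implicit Arguments.
Unset Strict Implicit.
Unset Printing Implicit Defensive.

Import Order.TTheory GRing.Theory Num.Theory.
Import numFieldNormedType.Exports.

Local Open Scope classical_set_scope.
Local Open Scope ring_scope.

(** The operator P(D) = D^4 - D^2 - b D - a has constant coefficients, so it
    factors as (D - r1) (D - r2) (D - r3) (D - r4), where the ri are the roots
    of the characteristic polynomial, and the whole question reduces to
    equations of order one.  At an imaginary point i d the polynomial takes the
    value d^4 + d^2 - a - i b d; since b is not zero this vanishes only for
    d = 0 and a = 0 (ode_poly_root_imaginary).  So for a > 0 no root is purely
    imaginary, and for a = 0 the only such root is 0, which is simple.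

    If Re r is not zero, the equation u' = r u + g has for every g in L^2 a
    solution in L^2 with norm at most that of g divided by |Re r|
    (solve_complex).  Multiplication by exp (- i Im r x), which preserves
    moduli, makes the coefficient real; the solution is then an integral of
    g against a one-sided decaying exponential, and the Schur test bounds it.
    For the root 0 one takes the primitive of f vanishing at - oo.  Because
    f has mean zero this primitive also vanishes at + oo, and because
    x f is integrable it is O(1/x) at both ends, hence in L^2 (solve_zero).

    Solving the first-order equations one after the other gives a solution u
    together with functions w 1, ..., w 4 in L^2 that are its successive weak
    derivatives, all bounded by the data (solvable_cons).  Uniqueness also goes
    factor by factor: if u' = r u weakly then exp (- r x) u has weak derivative
    zero, so it is constant by the lemma of du Bois-Reymond, and u = c exp (r x)
    is in L^2 only for c = 0 (solution_zero, weak_chain_zero).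

    Convergence is then a matter of linearity (well_posed): u_m - u is the
    solution with right-hand side f_m - f, and its H^4 norm is bounded by the
    size of f_m - f.  In the case a = 0 the limit f has mean zero too, since
    the mean is controlled by the L^2 norm and the first moment
    (mean_weighted_bound). *)

(** * Smooth functions *)

Section smooth.
Context {R : realType}.
Implicit Types (f g h : R -> R).

Definition smooth f : Prop := forall k x, derivable (derive1n k f) x 1.

Lemma smooth_derivable f x : smooth f -> derivable f x 1.
Proof. by move=> /(_ 0%N x). Qed.

Lemma smooth_derive1 f : smooth f -> smooth (derive1 f).
Proof. by move=> sf k x; rewrite -derive1Sn; exact: sf. Qed.

(** Coinduction principle: all the derivatives of a member of a family stay in
    it as soon as the first one does, so no formula for higher derivatives is
    ever needed. *)
Lemma smooth_coind (P : set (R -> R)) :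
  (forall f, P f -> exists2 df, P df & forall x : R, is_derive x 1 f (df x)) ->
  forall f, P f -> smooth f.
Proof.
move=> step f Pf k x.
suff : P (derive1n k f) by move=> /step[df _ /(_ x)[]].
elim: k => [|k]; first by rewrite derive1n0.
rewrite derive1nS => /step[df Pdf fdf]; suff -> : derive1 (derive1n k f) = df by [].
by apply/funext => y; rewrite derive1E; have [_ ->] := fdf y.
Qed.

Lemma smooth_is_derive f (x : R) : smooth f -> is_derive x 1 f ((derive1 f) x).
Proof. by move=> /smooth_derivable sf; rewrite derive1E; exact: derivableP. Qed.

(** The algebra generated by the smooth functions.  It is stable under
    differentiation by the Leibniz rule, which a family of mere products would
    not be; that is what [smooth_coind] requires. *)
Inductive smooth_expr : (R -> R) -> Prop :=
| smooth_atom f : smooth f -> smooth_expr f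
| smooth_add f g : smooth_expr f -> smooth_expr g -> smooth_expr (f \+ g)
| smooth_mul f g : smooth_expr f -> smooth_expr g -> smooth_expr (f \* g).

Lemma smooth_expr_smooth f : smooth_expr f -> smooth f.
Proof.
apply: smooth_coind => {}f; elim=> [{}f sf|{}f g _ [df edf fdf] _ [dg edg gdg]|].
- exists (derive1 f); first by apply: smooth_atom; exact: smooth_derive1.
  by move=> x; exact: smooth_is_derive.
- by exists (df \+ dg); [exact: smooth_add|move=> x; exact: is_deriveD].
- move=> {}f g ef [df edf fdf] eg [dg edg gdg].
  exists ((f \* dg) \+ (g \* df)).
    by apply: smooth_add; exact: smooth_mul.
  by move=> x; exact: is_deriveM.
Qed.

Lemma smoothD f g : smooth f -> smooth g -> smooth (f \+ g).
Proof.
by move=> sf sg; apply/smooth_expr_smooth/smooth_add; exact: smooth_atom.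
Qed.

Lemma smoothM f g : smooth f -> smooth g -> smooth (f \* g).
Proof.
by move=> sf sg; apply/smooth_expr_smooth/smooth_mul; exact: smooth_atom.
Qed.

Lemma smooth_cst (c : R) : smooth (fun=> c).
Proof.
apply: (smooth_coind (P := [set f | exists c, f = fun=> c])); last by exists c.
by move=> _ [d ->]; exists (fun=> 0); [exists 0|move=> x; exact: is_derive_cst].
Qed.

Lemma smoothZ (c : R) f : smooth f -> smooth (fun x => c * f x).
Proof. exact: (smoothM (@smooth_cst c)). Qed.

Lemma smooth_affine f (c d : R) : smooth f -> smooth (fun x => f (c * x + d)).
Proof.
move=> sf.
apply: (smooth_coind (P := [set g | exists e f, smooth f /\
  g = fun x => e * f (c * x + d)])); last first.
  by exists 1, f; split => //; apply/funext => x; rewrite mul1r.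
move=> _ [e [g [sg ->]]].
exists (fun x => (e * c) * (derive1 g) (c * x + d)).
  by exists (e * c), (derive1 g); split; [exact: smooth_derive1|].
move=> x.
have ? : is_derive (c * x + d) 1 g ((derive1 g) (c * x + d)).
  exact: smooth_is_derive.
have gcd : is_derive x 1 (fun y => g (c * y + d)) (derive1 g (c * x + d) * c).
  apply: (is_derive1_comp (f := g) (g := fun y => c * y + d)).
  by apply: is_derive_eq; rewrite /GRing.scale/= mulr1 addr0.
by apply: is_derive_eq; rewrite /GRing.scale/= mulrAC mulrA.
Qed.

Lemma smooth_expR : smooth (@expR R).
Proof.
apply: (smooth_coind (P := [set @expR R])) => // _ ->.
by exists expR => // x; exact: is_derive_expR.
Qed.

(** Neither sine nor cosine alone is stable under differentiation; their span
    is. *)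
Lemma smooth_sin_cos (c d : R) : smooth (fun x => c * sin x + d * cos x).
Proof.
apply: (smooth_coind (P := [set f | exists c d,
  f = fun x => c * sin x + d * cos x])); last by exists c, d.
move=> _ [{}c [{}d ->]].
exists (fun x => - d * sin x + c * cos x); first by exists (- d), c.
move=> x; by apply: is_derive_eq; rewrite /GRing.scale/= mulrN mulNr addrC.
Qed.

Lemma smooth_sin : smooth (@sin R).
Proof.
have := @smooth_sin_cos 1 0; congr smooth.
by apply/funext => x; rewrite mul1r mul0r addr0.
Qed.

Lemma smooth_cos : smooth (@cos R).
Proof.
have := @smooth_sin_cos 0 1; congr smooth.
by apply/funext => x; rewrite mul1r mul0r add0r.
Qed.

Lemma smooth_continuous f : smooth f -> continuous f.
Proof.
move=> sf x; apply/differentiable_continuous/derivable1_diffP.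
exact: smooth_derivable.
Qed.

End smooth.

Section flat.
Context {R : realType}.
Implicit Types (p : {poly R}) (x t : R).

(** For p = 1 this is the classical smooth function, exp (- 1 / x) on the
    positive half-line, all of whose derivatives vanish at 0.  The polynomial in
    1 / x makes the family stable under differentiation. *)
Definition flat p x : R := if 0 < x then p.[x^-1] * expR (- x^-1) else 0.

Lemma expR_ge_powdiv n t : 0 <= t -> t ^+ n <= n`!%:R * expR t.
Proof.
case: n => [|n] t0; first by rewrite expr0 fact0 mul1r -expR0 ler_expR.
rewrite mulrC -ler_pdivrMr ?ltr0n ?fact_gt0//.
by apply: le_trans (expR_ge1Dxn n t0); rewrite lerDr.
Qed.

(** Termwise, t ^ i <= i! exp t by the exponential series. *)
Lemma poly_expR_decay p : exists2 C : R, 0 <= C &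
  forall t, 0 <= t -> `|p.[t] * expR (- t)| <= C.
Proof.
exists (\sum_(i < size p) `|p`_i| * i`!%:R).
  by apply: sumr_ge0 => i _; rewrite mulr_ge0.
move=> t t0; rewrite normrM (ger0_norm (expR_ge0 _)) expRN ler_pdivrMr ?expR_gt0//.
rewrite horner_coef mulr_suml (le_trans (ler_norm_sum _ _ _))//.
apply: ler_sum => i _; rewrite normrM -mulrA ler_wpM2l//.
by rewrite ger0_norm ?exprn_ge0// expR_ge_powdiv.
Qed.

(** Quadratic flatness at 0 yields the derivative there; it is the
    boundedness of p(t) t^2 exp (- t) at t = 1 / x. *)
Lemma flat_le p : exists2 C : R, 0 < C & forall x, `|flat p x| <= C * x ^+ 2.
Proof.
have [C C0 pC] := poly_expR_decay (p * 'X^2).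
exists (1 + C) => [|x]; [exact: ltr_wpDr|rewrite /flat].
case: ifPn => [x0|_]; last by rewrite normr0 mulr_ge0 ?sqr_ge0 ?addr_ge0.
have := pC x^-1; rewrite invr_ge0 (ltW x0) => /(_ isT).
rewrite hornerM hornerXn -mulrA [_^-1 ^+ 2 * _]mulrC mulrA normrM.
rewrite [X in _ * X]ger0_norm ?sqr_ge0// exprVn ler_pdivrMr ?exprn_gt0//.
by move=> /le_trans; apply; rewrite ler_wpM2r ?sqr_ge0// lerDr.
Qed.

Lemma is_derive_flat p x :
  is_derive x 1 (flat p) (flat (('X ^+ 2) * (p - p^`()%R)) x).
Proof.
have [x0|x0|->] := ltrgt0P x.
- have xn0 : x != 0 by rewrite gt_eqF.
  apply: (@near_eq_is_derive R R R (fun y => p.[y^-1] * expR (- y^-1))) => //.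
    near=> y; rewrite /flat ifT//; near: y; exact: lt_nbhsr.
  have dV : is_derive x 1 (fun y : R => y^-1) (- x ^- 2).
    have := is_deriveV (f := id) xn0 (is_derive_id x 1).
    by rewrite /GRing.scale/= mulr1.
  have dp : is_derive x 1 (fun y : R => p.[y^-1]) (p^`()%R.[x^-1] * - x ^- 2).
    by apply: (is_derive1_comp (f := horner p) (g := fun y => y^-1)).
  have de : is_derive x 1 (fun y : R => expR (- y^-1)) (expR (- x^-1) * x ^- 2).
    apply: (is_derive1_comp (f := expR) (g := fun y => - y^-1)).
    by apply: is_derive_eq; rewrite opprK.
  apply: is_derive_eq; rewrite /flat x0 !hornerE /GRing.scale/=.
  by rewrite -exprVn; ring.
- apply: (@near_eq_is_derive R R R (cst 0)) => //.
    near=> y; rewrite /flat ifF//; apply/negbTE; rewrite -leNgt ltW//.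
    by near: y; exact: lt_nbhsl.
  by rewrite /flat ifF; [exact: is_derive_cst|apply/negbTE; rewrite -leNgt ltW].
- have [C C0 pC] := flat_le p.
  have fl0 : flat p 0 = 0 by rewrite /flat ltxx.
  have lim0 : h^-1 *: ((flat p \o shift 0) (h *: 1) - flat p 0) @[h --> 0^'] --> (0:R).
    apply/cvgr0Pnorm_le => e e0; near=> h.
    have h0 : h != 0 by near: h; exact: nbhs_dnbhs_neq.
    rewrite fl0 subr0 /= addr0 /GRing.scale/= mulr1 normrM normfV ler_pdivrMl ?normr_gt0//.
    apply: le_trans (pC h) _; rewrite -normr_id -[h ^+ 2]real_normK ?num_real// expr2.
    rewrite mulrCA normr_id ler_wpM2l ?(ltW C0)//.
    by rewrite mulrC -ler_pdivlMr//; near: h; apply: dnbhs0_le; exact: divr_gt0.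
  rewrite /flat ltxx; apply: DeriveDef; first by apply/cvg_ex; exists 0.
  exact/cvg_lim.
Unshelve. all: by end_near. Qed.

Lemma smooth_flat p : smooth (flat p).
Proof.
apply: (smooth_coind (P := [set f | exists p, f = flat p])); last by exists p.
by move=> _ [q ->]; exists (flat ('X ^+ 2 * (q - q^`()%R)));
  [exists ('X ^+ 2 * (q - q^`()%R))|exact: is_derive_flat].
Qed.

End flat.

(** * Test functions *)

Section test_functions.
Context {R : realType}.
Implicit Types (f phi chi : R -> R) (M : R).
Local Notation mu := (@lebesgue_measure R).

Definition vanishes_beyond M phi := forall x, M < `|x| -> phi x = 0.

(** A compact support is handled below through a bound M on its points. *)
Lemma test_functionP phi :
  test_function phi <-> smooth phi /\ exists M, vanishes_beyond M phi.
Proof.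
split=> [[sphi cphi]|[sphi [M phiM]]]; split => //.
  have [M [_ MP]] := compact_bounded cphi.
  exists (M + 1) => x Mx; apply/eqP; apply: contraT => phix.
  have /= := MP (M + 1); rewrite ltrDl ltr01 => /(_ isT x).
  by rewrite leNgt Mx => /(_ (@subset_closure R [set x | phi x != 0] x phix)).
apply: (@subclosed_compact _ _ `[- M, M]); [exact: closed_closure|exact: segment_compact|].
have /closure_id -> : closed `[- M, M] by exact: interval_closed.
apply: closureS => x /= phix; rewrite in_itv/= -ler_norml leNgt.
by apply: contra phix => Mx; rewrite phiM.
Qed.

Lemma vanishes_le M N phi : M <= N -> vanishes_beyond M phi -> vanishes_beyond N phi.
Proof. by move=> MN phiM x Nx; apply: phiM; exact: le_lt_trans Nx. Qed.

Lemma vanishes_derive1 M phi : vanishes_beyond M phi -> vanishes_beyond M (derive1 phi).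
Proof.
move=> phiM x Mx; rewrite derive1E.
rewrite (@near_eq_derive R R R phi (cst 0)) ?derive_cst//.
near=> y; apply: phiM; near: y.
apply: (@cvgr_gt R R (nbhs x) _ Num.norm `|x|) => //.
exact: (@norm_continuous R R x).
Unshelve. all: by end_near. Qed.

Lemma test_derive1 phi : test_function phi -> test_function (derive1 phi).
Proof.
move=> /test_functionP[sphi [M phiM]]; apply/test_functionP.
by split; [exact: smooth_derive1|exists M; exact: vanishes_derive1].
Qed.

Lemma testM chi phi : smooth chi -> test_function phi -> test_function (chi \* phi).
Proof.
move=> schi /test_functionP[sphi [M phiM]]; apply/test_functionP.
split; first exact: smoothM.
by exists M => x Mx /=; rewrite phiM// mulr0.
Qed.

Lemma testD phi chi : test_function phi -> test_function chi -> test_function (phi \+ chi).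
Proof.
move=> /test_functionP[sphi [M phiM]] /test_functionP[schi [N phiN]].
apply/test_functionP; split; first exact: smoothD.
exists (Num.max M N) => x; rewrite gt_max => /andP[Mx Nx] /=.
by rewrite phiM// phiN// addr0.
Qed.

Lemma testZ c phi : test_function phi -> test_function (fun x => c * phi x).
Proof. exact: (testM (@smooth_cst R c)). Qed.

(** A smooth approximation from below of the indicator of ]c, d[, to which it
    tends pointwise as n grows. *)
Definition bump (c d : R) (n : nat) (x : R) : R :=
  flat 1 (n.+1%:R * (x - c)) * flat 1 (n.+1%:R * (d - x)).

Lemma flat1_ge0 x : 0 <= flat 1 x :> R.
Proof. by rewrite /flat; case: ifP => // _; rewrite hornerC mul1r expR_ge0. Qed.

Lemma flat1_le1 x : flat 1 x <= 1 :> R.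
Proof.
rewrite /flat; case: ifPn => // x0; rewrite hornerC mul1r -expR0 ler_expR.
by rewrite oppr_le0 invr_ge0 ltW.
Qed.

Lemma bump_ge0 c d n x : 0 <= bump c d n x.
Proof. by rewrite mulr_ge0 ?flat1_ge0. Qed.

Lemma bump_le1 c d n x : bump c d n x <= 1.
Proof. by rewrite mulr_ile1 ?flat1_ge0 ?flat1_le1. Qed.

Lemma flat1_eq0 x : x <= 0 -> flat 1 x = 0 :> R.
Proof. by move=> x0; rewrite /flat ltNge x0. Qed.

Lemma bump_eq0 c d n x : x \notin `]c, d[ -> bump c d n x = 0.
Proof.
rewrite in_itv/= negb_and -!leNgt => /orP[xc|dx]; rewrite /bump.
  by rewrite (@flat1_eq0 (_ * _)) ?mul0r// pmulr_rle0 ?subr_le0.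
by rewrite (@flat1_eq0 (_ * (d - x))) ?mulr0// pmulr_rle0 ?subr_le0.
Qed.

Lemma bump_cvg c d x : bump c d n x @[n --> \oo] --> (\1_`]c, d[ x : R).
Proof.
rewrite indicE; have [|xcd] := boolP (x \in `]c, d[); last first.
  rewrite memNset; last exact/negP.
  by under eq_cvg do rewrite bump_eq0//; exact: cvg_cst.
move=> xcd; rewrite mem_set//=; move: xcd; rewrite in_itv/= => /andP[cx xd].
have fl (y : R) : 0 < y -> flat 1 (n.+1%:R * y) @[n --> \oo] --> (1:R).
  move=> y0; have -> : (fun n => flat 1 (n.+1%:R * y)) = (fun n => expR (- (n.+1%:R^-1 * y^-1))).
    by apply/funext => n; rewrite /flat pmulr_rgt0// y0 hornerC mul1r invfM.
  have : expR (- (n.+1%:R^-1 * y^-1)) @[n --> \oo] --> expR (- (0 * y^-1)).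
    apply: continuous_cvg; first exact: continuous_expR.
    by apply: cvgN; apply: cvgM; [exact: cvg_harmonic|exact: cvg_cst].
  by rewrite mul0r oppr0 expR0.
have := cvgM (fl (x - c) _) (fl (d - x) _).
by rewrite mulr1 !subr_gt0; exact.
Qed.

Lemma test_bump c d n : test_function (bump c d n).
Proof.
apply/test_functionP; split.
  apply: smoothM.
    rewrite (_ : (fun x => _) = fun x => flat 1 (n.+1%:R * x + (- n.+1%:R * c))).
      by apply: smooth_affine; exact: smooth_flat.
    by apply/funext => x; rewrite mulrBr mulNr.
  rewrite (_ : (fun x => _) = fun x => flat 1 (- n.+1%:R * x + n.+1%:R * d)).
    by apply: smooth_affine; exact: smooth_flat.
  by apply/funext => x; rewrite mulrBr addrC mulNr.
exists (Num.max `|c| `|d|) => x; rewrite gt_max => /andP[cx dx]; apply: bump_eq0.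
rewrite in_itv/=; apply/negP => /andP[cx' xd].
have := ler_norm d; have := ler_norm (- c); rewrite normrN.
by move: cx dx; rewrite !ltr_normr => /orP[] + /orP[]; lra.
Qed.
End test_functions.

Section test_integrals.
Context {R : realType}.
Implicit Types (u phi chi : R -> R) (M : R).
Local Notation mu := (@lebesgue_measure R).

Lemma test_smooth phi : test_function phi -> smooth phi.
Proof. by move=> /test_functionP[]. Qed.

Lemma test_supp phi : test_function phi -> exists2 M : R, 0 < M & vanishes_beyond M phi.
Proof.
move=> /test_functionP[_ [M phiM]]; exists (Num.max M 1); first by rewrite lt_max ltr01 orbT.
by apply: vanishes_le phiM; rewrite le_max lexx.
Qed.

Lemma smooth_measurable phi : smooth phi -> measurable_fun setT phi.
Proof. by move=> sphi; apply: continuous_measurable_fun; exact: smooth_continuous. Qed.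

Lemma test_measurable phi : test_function phi -> measurable_fun setT phi.
Proof. by move=> /test_smooth; exact: smooth_measurable. Qed.

Lemma continuous_bounded_itv chi (a b : R) : continuous chi ->
  exists2 C : R, 0 <= C & forall x, x \in `[a, b] -> `|chi x| <= C.
Proof.
move=> cchi.
have /compact_bounded[C [_ CP]] : compact (chi @` `[a, b]).
  apply: continuous_compact; last exact: segment_compact.
  exact: continuous_subspaceT.
exists (`|C| + 1); first by rewrite addr_ge0.
move=> x xab; apply: (CP (`|C| + 1)); last by exists x.
by rewrite (le_lt_trans (ler_norm C))// ltrDl.
Qed.

Lemma locally_integrable_itv u (a b : R) : locally_integrable setT u ->
  mu.-integrable `[a, b] (EFin \o u).
Proof.
move=> [mu_ _ ui]; apply/integrableP; split.
  by apply/measurable_EFinP; exact: measurable_funTS.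
by apply: ui => //; exact: segment_compact.
Qed.

Lemma locally_integrable_of_itv u : measurable_fun setT u ->
  (forall a b : R, mu.-integrable `[a, b] (EFin \o u)) -> locally_integrable setT u.
Proof.
move=> mu_ ui; split => //; first exact: openT.
move=> K _ cK; have [M [_ MP]] := compact_bounded cK.
have KM : K `<=` `[- (M + 1), M + 1].
  by move=> x Kx; rewrite /= in_itv/= -ler_norml; apply: (MP (M + 1)) => //; rewrite ltrDl.
have /integrableP[_] := ui (- (M + 1)) (M + 1); apply: le_lt_trans.
apply: ge0_subset_integral => //; first exact: compact_measurable.
by apply/measurable_EFinP; apply: measurableT_comp => //; exact: measurable_funTS.
Qed.

Lemma integrable_vanishing u M : vanishes_beyond M u ->
  mu.-integrable `[- M, M] (EFin \o u) -> mu.-integrable setT (EFin \o u).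
Proof.
move=> uM ui; have /integrable_mkcond := ui; move=> /(_ (measurable_itv _)).
apply: eq_integrable => // x _; rewrite patchE; case: ifPn => //=.
rewrite notin_setE/= in_itv/= -ler_norml => /negP; rewrite -ltNge => Mx.
by rewrite uM.
Qed.

Lemma integrable_mul_continuous u chi (a b : R) : locally_integrable setT u ->
  continuous chi -> mu.-integrable `[a, b] (EFin \o (u \* chi)).
Proof.
move=> ui cchi; have [C C0 CP] := continuous_bounded_itv a b cchi.
rewrite (_ : EFin \o _ = (EFin \o u) \* (EFin \o chi))%E//.
apply: integrableMl.
- exact: measurable_itv.
- exact: locally_integrable_itv.
- by apply: measurable_funTS; exact: continuous_measurable_fun.
- exists C; split; first exact: num_real.
  by move=> N CN x /= xab; rewrite (le_trans (CP _ xab))// ltW.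
Qed.

Lemma locally_integrable_mul u chi : locally_integrable setT u -> continuous chi ->
  locally_integrable setT (u \* chi).
Proof.
move=> ui cchi; apply: locally_integrable_of_itv; last first.
  by move=> a b; exact: integrable_mul_continuous.
by apply: measurable_funM; [case: ui|exact: continuous_measurable_fun].
Qed.

(** Together with [locally_integrable_mul], this makes every pairing of the weak
    formulations a convergent integral, so that integrals may be split
    freely. *)
Lemma integrable_mul_test u phi : locally_integrable setT u -> test_function phi ->
  mu.-integrable setT (EFin \o (u \* phi)).
Proof.
move=> ui tphi; have [M M0 phiM] := test_supp tphi.
apply: (@integrable_vanishing _ M).
  by move=> x Mx /=; rewrite phiM// mulr0.
by apply: integrable_mul_continuous => //; exact/smooth_continuous/test_smooth.
Qed.

Lemma integrable_test phi : test_function phi -> mu.-integrable setT (EFin \o phi).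
Proof.
move=> tphi; have [M M0 phiM] := test_supp tphi.
apply: (integrable_vanishing phiM); apply: continuous_compact_integrable.
  exact: segment_compact.
by apply: continuous_subspaceT; exact/smooth_continuous/test_smooth.
Qed.

Lemma integral_derive1 phi (a b : R) : smooth phi -> a < b ->
  \int[mu]_(x in `[a, b]) derive1 phi x = phi b - phi a.
Proof.
move=> sphi ab; rewrite /Rintegral (@continuous_FTC2 _ _ phi)//.
- by apply: continuous_subspaceT; exact/smooth_continuous/smooth_derive1.
- split=> [x _||].
  + exact: smooth_derivable.
  + exact/cvg_at_right_filter/smooth_continuous.
  + exact/cvg_at_left_filter/smooth_continuous.
Qed.

Lemma integral_test_tail phi (y : R) : test_function phi ->
  \int[mu]_(x in `[y, +oo[) derive1 phi x = - phi y.
Proof.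
move=> tphi; have [M M0 phiM] := test_supp tphi.
(* a point to the right of both y and the support *)
pose N := Num.max M `|y| + 1.
have MN : M < N by rewrite ltr_pwDr// le_max lexx.
have yN : y < N by rewrite (le_lt_trans (ler_norm y))// ltr_pwDr// le_max lexx orbT.
have phiN : phi N = 0 by apply: phiM; rewrite (lt_le_trans MN)// ler_norm.
transitivity (\int[mu]_(x in `[y, N]) derive1 phi x); last first.
  by rewrite integral_derive1 ?phiN ?sub0r//; exact: test_smooth.
rewrite Rintegral_mkcond [RHS]Rintegral_mkcond; apply: eq_Rintegral => x _.
rewrite !patchE; case: ifPn => [|xy]; last first.
  rewrite ifF//; apply/negbTE; apply: contra xy; rewrite !inE/= !in_itv/= andbT.
  by move=> /andP[].
rewrite inE/= in_itv/= andbT => yx; case: ifPn => //.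
rewrite notin_setE/= in_itv/= yx/= => /negP; rewrite -ltNge => Nx.
by apply: (vanishes_derive1 phiM); rewrite (lt_le_trans (lt_trans MN Nx))// ler_norm.
Qed.

(** The primitive from - oo vanishes to the left of the support, and also to
    its right because the total integral is zero. *)
Lemma test_primitive phi : test_function phi -> \int[mu]_x phi x = 0 ->
  exists2 Phi, test_function Phi & derive1 Phi = phi.
Proof.
move=> tphi phi0; have [M M0 phiM] := test_supp tphi.
have iphi := integrable_test tphi.
pose Phi (x : R) := \int[mu]_(t in `]-oo, x]) phi t.
have PhiE x : derivable Phi x 1 /\ derive1 Phi x = phi x.
  apply: (@continuous_FTC1 _ phi -oo%O x (x + 1)); rewrite ?ltrDl ?ltNyr//.
  - by apply: integrableS iphi.
  - exact/smooth_continuous/test_smooth.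
have dPhi : derive1 Phi = phi by apply/funext => x; exact: (PhiE x).2.
exists Phi => //; apply/test_functionP; split.
  apply: (smooth_coind (P := [set f | f = Phi \/ smooth f])); last by left.
  move=> f [->|sf].
    exists phi; first by right; exact: test_smooth.
    move=> x; apply: DeriveDef; first exact: (PhiE x).1.
    by rewrite -derive1E dPhi.
  exists (derive1 f); first by right; exact: smooth_derive1.
  by move=> x; exact: smooth_is_derive.
exists M => x; rewrite ltr_normr => /orP[Mx|Mx].
  rewrite -phi0 /Phi Rintegral_mkcond; apply: eq_Rintegral => t _.
  rewrite patchE; case: ifPn => //; rewrite notin_setE/= in_itv/= => /negP.
  rewrite -ltNge => xt; rewrite phiM// (lt_le_trans (lt_trans Mx xt))// ler_norm.
  by [].
rewrite /Phi Rintegral_mkcond -[RHS](Rintegral_set0 mu phi) [RHS]Rintegral_mkcond.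
apply: eq_Rintegral => t _; rewrite !patchE in_set0; case: ifPn => //.
rewrite inE/= in_itv/= => tx; rewrite phiM// (lt_le_trans Mx)//.
by rewrite (@le_trans _ _ (- t)) ?lerN2// -normrN ler_norm.
Qed.

Lemma integral_test_derive1 phi : test_function phi -> \int[mu]_x derive1 phi x = 0.
Proof.
move=> tphi; have [M M0 phiM] := test_supp tphi.
transitivity (\int[mu]_(x in `[- (M + 1), +oo[) derive1 phi x); last first.
  rewrite integral_test_tail// phiM ?oppr0// normrN.
  by rewrite (lt_le_trans _ (ler_norm _))// ltrDl.
rewrite [RHS]Rintegral_mkcond; apply: eq_Rintegral => x _.
rewrite patchE; case: ifPn => //; rewrite notin_setE/= in_itv/= andbT => /negP.
rewrite -ltNge => xM; apply: (vanishes_derive1 phiM).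
rewrite (@lt_le_trans _ _ (- x))//; last by rewrite -normrN ler_norm.
by rewrite ltrNr (lt_trans xM)// ltrN2 ltrDl.
Qed.

End test_integrals.

(** * The fundamental lemma of the calculus of variations *)

Section fundamental.
Context {R : realType}.
Implicit Types (g u phi chi : R -> R) (c d : R).
Local Notation mu := (@lebesgue_measure R).

Lemma ae_imply (P Q : R -> Prop) : (forall x, P x -> Q x) ->
  {ae mu, forall x, P x} -> {ae mu, forall x, Q x}.
Proof. by move=> PQ; apply: filterS => //; exact: (ae_filter_ringOfSetsType mu). Qed.

Lemma ae_imply2 (P Q S : R -> Prop) : (forall x, P x -> Q x -> S x) ->
  {ae mu, forall x, P x} -> {ae mu, forall x, Q x} -> {ae mu, forall x, S x}.
Proof. by move=> PQ; apply: filterS2 => //; exact: (ae_filter_ringOfSetsType mu). Qed.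

(** Dominated convergence, the bumps being bounded by 1 and supported in
    [c, d]. *)
Lemma integral_itv_bump g c d : locally_integrable setT g ->
  (forall n, \int[mu]_x (g x * bump c d n x) = 0) ->
  (\int[mu]_(x in `]c, d[) (g x)%:E = 0)%E.
Proof.
move=> gi g0.
have mg : measurable_fun setT g by case: gi.
have gcd : mu.-integrable `]c, d[ (EFin \o g).
  apply: (integrableS _ _ _ (locally_integrable_itv c d gi)) => //.
  exact: subset_itv_oo_cc.
have gcdT : mu.-integrable setT (EFin \o (g \_ `]c, d[)).
  by have /integrable_mkcond := gcd; rewrite restrict_EFin; apply.
have [| | | | |_ _] := @dominated_convergence _ _ R mu setT measurableT
  (fun n x => (g x * bump c d n x)%:E) (EFin \o (g \_ `]c, d[))
  (abse \o (EFin \o (g \_ `]c, d[))).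
- move=> n; apply/measurable_EFinP/measurable_funM => //.
  by apply: test_measurable; exact: test_bump.
- by case/integrableP : gcdT.
- apply: aeW => x _ /=; apply: cvg_EFin; first exact: nearW.
  rewrite (_ : (g \_ _) x = g x * \1_`]c, d[ x); last first.
    by rewrite indicE patchE; case: ifPn => _; rewrite ?mulr1 ?mulr0.
  by apply: cvgM; [exact: cvg_cst|exact: bump_cvg].
- exact: integrable_abse.
- apply: aeW => x n _ /=; rewrite lee_fin patchE; case: ifPn => [|xcd].
    by move=> _; rewrite normrM ler_piMr// ger0_norm ?bump_ge0// bump_le1.
  by rewrite bump_eq0 ?mulr0//; apply: contra xcd; rewrite inE.
rewrite [X in _ --> X](_ : _ = (\int[mu]_(x in `]c, d[) (g x)%:E)%E); last first.
  by rewrite [RHS]integral_mkcond restrict_EFin.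
move=> /cvg_lim <- //; apply/cvg_lim => //.
rewrite (_ : (fun n => _) = cst 0%E); first exact: cvg_cst.
apply/funext => n /=; rewrite -[LHS]fineK; last first.
  apply: integrable_fin_num => //; apply: integrable_mul_test => //.
  exact: test_bump.
by congr EFin; exact: g0.
Qed.

(** By Lebesgue's differentiation theorem almost every value g x is a limit of
    means of g over balls around x, and these means vanish. *)
Lemma ae_eq0_of_integral_itv g : locally_integrable setT g ->
  (forall c d, (\int[mu]_(x in `]c, d[) (g x)%:E = 0)%E) ->
  {ae mu, forall x, g x = 0}.
Proof.
move=> gi g0.
pose E (x : R) (n : nat) : set R := ball x n.+1%:R^-1.
have hE x : nicely_shrinking x (E x).
  split; first by move=> n; exact: measurable_ball.
  exists (1, fun n => (n.+1%:R^-1)%:pos); split => //=.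
  - exact: cvg_harmonic.
  - by move=> n.
  - by move=> n; rewrite mul1e.
have := lebesgue_differentiation gi; apply: ae_imply => x /=.
move=> /(nice_lebesgue_differentiation hE gi).
rewrite (_ : (fun n => _) = cst 0%E); last first.
  by apply/funext => n; rewrite /E ball_itv g0 mule0.
by move=> /(cvg_unique _ (@cvg_cst _ _ _ _ _)) => /(_ (@ereal_hausdorff R)) [<-].
Qed.

Lemma fundamental_lemma g : locally_integrable setT g ->
  (forall phi, test_function phi -> \int[mu]_x (g x * phi x) = 0) ->
  {ae mu, forall x, g x = 0}.
Proof.
move=> gi g0; apply: ae_eq0_of_integral_itv => // c d.
by apply: integral_itv_bump => // n; apply: g0; exact: test_bump.
Qed.

Lemma locally_integrable_cst c : locally_integrable setT (fun _ : R => c).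
Proof.
apply: locally_integrable_of_itv => // a b; apply: continuous_compact_integrable.
  exact: segment_compact.
by apply: continuous_subspaceT => x; exact: cvg_cst.
Qed.

(** For a fixed eta of nonzero integral, any test function psi minus a suitable
    multiple of eta has integral zero, hence is the derivative of a test
    function.  So the integral of u psi is c times that of psi, where c is
    determined by eta alone, and the fundamental lemma applies to u - c. *)
Lemma du_Bois_Reymond u : locally_integrable setT u ->
  (forall phi, test_function phi -> \int[mu]_x (u x * derive1 phi x) = 0) ->
  exists c, {ae mu, forall x, u x = c}.
Proof.
move=> ui u0.
(* the integrals of the bumps over ]0, 1[ tend to 1, so one is nonzero *)
have [n eta0] : exists n, \int[mu]_x bump 0 1 n x != 0.
  apply: contrapT => /forallNP int0.
  have : (\int[mu]_(x in `]0%R, 1%R[) (1 : R)%:E = 0)%E.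
    apply: (@integral_itv_bump (cst 1)); first exact: locally_integrable_cst.
    move=> n; have /negP/negPn/eqP h := int0 n; rewrite -[RHS]h.
    by apply: eq_Rintegral => x _; rewrite mul1r.
  rewrite integral_cst//= mul1e lebesgue_measure_itv/= lte_fin ltr01 oppr0 adde0.
  by move=> /eqP; rewrite eqe oner_eq0.
set eta := bump 0 1 n in eta0; have teta : test_function eta by exact: test_bump.
pose c := (\int[mu]_x (u x * eta x)) / \int[mu]_x eta x.
exists c.
suff : {ae mu, forall x, (u \- cst c) x = 0}.
  by apply: ae_imply => x /= /eqP; rewrite subr_eq0 => /eqP.
apply: fundamental_lemma; first by apply: locally_integrableB => //; exact: locally_integrable_cst.
move=> psi tpsi; pose m := (\int[mu]_x psi x) / \int[mu]_x eta x.
have tchi : test_function (psi \+ (fun x => - m * eta x)).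
  by apply: testD => //; exact: testZ.
have [Chi tChi ChiE] : exists2 Chi, test_function Chi &
    derive1 Chi = psi \+ (fun x => - m * eta x).
  apply: test_primitive => //.
  rewrite RintegralD//; [|exact: integrable_test|]; last first.
    by apply: integrable_test; exact: testZ.
  rewrite RintegralZl//; last exact: integrable_test.
  by rewrite mulNr divfK// subrr.
have := u0 _ tChi; rewrite ChiE.
under eq_Rintegral => x _ do rewrite /= mulNr mulrBr (mulrCA (u x)).
have iu phi : test_function phi -> mu.-integrable setT (EFin \o (fun x => u x * phi x)).
  exact: integrable_mul_test.
have ic phi : test_function phi -> mu.-integrable setT (EFin \o (fun x => c * phi x)).
  by move=> tphi; apply: integrable_test; exact: testZ.
rewrite RintegralB//; [|exact: iu|]; last first.
  have := iu _ (testZ m teta); apply: eq_integrable => // x _ /=.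
  by rewrite mulrCA.
rewrite RintegralZl//; last exact: iu.
move=> /eqP; rewrite subr_eq0 => /eqP upsi.
under eq_Rintegral => x _ do rewrite /= mulrBl.
rewrite RintegralB//; [|exact: iu|exact: ic].
rewrite RintegralZl//; last exact: integrable_test.
by rewrite upsi /m /c; ring.
Qed.

End fundamental.

(** * Weak derivatives of real functions *)

Section real_weak_derivative.
Context {R : realType}.
Implicit Types (u v w phi chi : R -> R) (c : R).
Local Notation mu := (@lebesgue_measure R).

(** The real analogue of [is_weak_derivative], which splits into one such
    statement for the real part and one for the imaginary part. *)
Definition rweak k u v : Prop :=
  [/\ locally_integrable setT u, locally_integrable setT v &
    forall phi, test_function phi ->
      \int[mu]_x (u x * derive1n k phi x) = (-1) ^+ k * \int[mu]_x (v x * phi x)].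

Lemma test_derive1n k phi : test_function phi -> test_function (derive1n k phi).
Proof.
by elim: k phi => [//|k IH] phi tphi; rewrite derive1nS; exact/test_derive1/IH.
Qed.

Lemma rweakD k u v u' v' : rweak k u v -> rweak k u' v' ->
  rweak k (u \+ u') (v \+ v').
Proof.
move=> [ui vi uv] [ui' vi' uv']; split; [exact: locally_integrableD|exact: locally_integrableD|].
move=> phi tphi; have tkphi := test_derive1n k tphi.
under eq_Rintegral do rewrite mulrDl.
rewrite RintegralD//; [|exact: integrable_mul_test|exact: integrable_mul_test].
rewrite uv// uv'// -mulrDr; congr (_ * _).
under [RHS]eq_Rintegral do rewrite mulrDl.
by rewrite RintegralD//; exact: integrable_mul_test.
Qed.

Lemma locally_integrableZ c u : locally_integrable setT u ->
  locally_integrable setT (fun x => c * u x).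
Proof.
move=> ui; rewrite (_ : (fun x => _) = u \* (fun=> c)).
  by apply: locally_integrable_mul => // x; exact: cvg_cst.
by apply/funext => x; rewrite mulrC.
Qed.

Lemma rweakZ k c u v : rweak k u v ->
  rweak k (fun x => c * u x) (fun x => c * v x).
Proof.
move=> [ui vi uv]; split; [exact: locally_integrableZ|exact: locally_integrableZ|].
move=> phi tphi; have tkphi := test_derive1n k tphi.
under eq_Rintegral do rewrite -mulrA.
rewrite RintegralZl//; last exact: integrable_mul_test.
under [in RHS]eq_Rintegral do rewrite -mulrA.
rewrite RintegralZl//; last exact: integrable_mul_test.
by rewrite uv// mulrCA.
Qed.

Lemma ae_eq_Rintegral u v : measurable_fun setT u -> measurable_fun setT v ->
  {ae mu, forall x, u x = v x} -> \int[mu]_x u x = \int[mu]_x v x.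
Proof.
move=> mu_ mv uv; congr fine; apply: ae_eq_integral => //.
- exact/measurable_EFinP.
- exact/measurable_EFinP.
- by apply: ae_imply uv => x -> _.
Qed.

Lemma ae_eq_locally_integrable u v : {ae mu, forall x, u x = v x} ->
  measurable_fun setT v -> locally_integrable setT u -> locally_integrable setT v.
Proof.
move=> uv mv [mu_ oT ui]; split => // K KT cK.
rewrite (_ : (\int[mu]_(x in K) _ = \int[mu]_(x in K) `|u x|%:E)%E); first exact: ui.
apply: ae_eq_integral.
- exact: compact_measurable.
- by apply/measurable_EFinP/measurableT_comp => //; exact: measurable_funTS.
- by apply/measurable_EFinP/measurableT_comp => //; exact: measurable_funTS.
- by apply: ae_imply uv => x -> _.
Qed.

Lemma ae_eq_rweak k u v u' v' : measurable_fun setT u' -> measurable_fun setT v' ->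
  {ae mu, forall x, u x = u' x} -> {ae mu, forall x, v x = v' x} ->
  rweak k u v -> rweak k u' v'.
Proof.
move=> mu' mv' uu' vv' [ui vi uv]; split.
- exact: ae_eq_locally_integrable ui.
- exact: ae_eq_locally_integrable vi.
move=> phi tphi; have mphi := test_measurable tphi.
have mkphi := test_measurable (test_derive1n k tphi).
have [mu_ _ _] := ui; have [mv_ _ _] := vi.
have <- := @ae_eq_Rintegral (fun x => u x * derive1n k phi x) (fun x => u' x * derive1n k phi x).
- have <- := @ae_eq_Rintegral (fun x => v x * phi x) (fun x => v' x * phi x).
  + exact: uv.
  + exact: measurable_funM.
  + exact: measurable_funM.
  + by apply: ae_imply vv' => x ->.
- exact: measurable_funM.
- exact: measurable_funM.
- by apply: ae_imply uu' => x ->.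
Qed.

Lemma rweak_unique k u v w : rweak k u v -> rweak k u w ->
  {ae mu, forall x, v x = w x}.
Proof.
move=> [_ vi uv] [_ wi uw].
suff : {ae mu, forall x, (v \- w) x = 0}.
  by apply: ae_imply => x /eqP; rewrite subr_eq0 => /eqP.
apply: fundamental_lemma; first exact: locally_integrableB.
move=> phi tphi; under eq_Rintegral do rewrite mulrBl.
rewrite RintegralB//; [|exact: integrable_mul_test|exact: integrable_mul_test].
apply/eqP; rewrite subr_eq0 -(inj_eq (mulfI (_ : (-1) ^+ k != 0))) ?signr_eq0//.
by rewrite -uv// -uw.
Qed.

(** The derivative of a test function is again a test function, so weak
    derivatives compose; [rweak_next] is the converse, that consecutive weak
    derivatives of u are related by a first-order derivative. *)
Lemma rweak_trans k u v w : rweak k u v -> rweak 1 v w -> rweak k.+1 u w.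
Proof.
move=> [ui vi uv] [_ wi vw]; split => // phi tphi.
rewrite derive1Sn uv; last exact: test_derive1.
by rewrite -derive1n1 vw// mulrA -exprD addn1.
Qed.

Lemma rweak_next k u v w : rweak k u v -> rweak k.+1 u w -> rweak 1 v w.
Proof.
move=> [ui vi uv] [_ wi uw]; split => // phi tphi.
apply: (mulfI (_ : (-1) ^+ k != 0)); first by rewrite signr_eq0.
rewrite mulrA -exprD addn1 -uw// [in RHS]derive1Sn uv; last exact: test_derive1.
by rewrite derive1n1.
Qed.

(** Test the weak derivative of u on chi phi. *)
Lemma rweakM chi u v : smooth chi -> rweak 1 u v ->
  rweak 1 (chi \* u) (derive1 chi \* u \+ chi \* v).
Proof.
move=> schi [ui vi uv].
have cchi := smooth_continuous schi.
have cdchi := smooth_continuous (smooth_derive1 schi).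
have iM (f g : R -> R) : continuous f -> locally_integrable setT g ->
    locally_integrable setT (f \* g).
  move=> cf ig; rewrite (_ : f \* g = g \* f); first exact: locally_integrable_mul.
  by apply/funext => x /=; rewrite mulrC.
split; [exact: iM|by apply: locally_integrableD; exact: iM|move=> phi tphi].
have tchiphi := testM schi tphi.
have tdchiphi := testM (smooth_derive1 schi) tphi.
have := uv _ tchiphi; rewrite !derive1n1 !expr1 !mulN1r.
have -> : derive1 (chi \* phi) = derive1 chi \* phi \+ chi \* derive1 phi.
  apply/funext => x; rewrite derive1E.
  have ? := smooth_is_derive x schi.
  have ? := smooth_is_derive x (test_smooth tphi).
  rewrite (@derive_val _ _ _ _ _ _ _ (is_deriveM _ _))//=.
  by rewrite /GRing.scale/= addrC mulrC.
under eq_Rintegral do rewrite /= mulrDr.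
rewrite RintegralD//; last 2 first.
- exact: integrable_mul_test.
- exact: (integrable_mul_test ui (testM schi (test_derive1 tphi))).
move=> /eqP; rewrite addrC -subr_eq0 opprK -addrA addr_eq0 => /eqP.
under eq_Rintegral do rewrite mulrCA mulrA.
move=> ->; congr (- _).
under [RHS]eq_Rintegral do rewrite /= mulrDl.
rewrite RintegralD//; last 2 first.
- by apply: integrable_mul_test => //; exact: iM.
- by apply: integrable_mul_test => //; exact: iM.
by congr (_ + _); apply: eq_Rintegral => x _ /=; rewrite mulrCA mulrA.
Qed.

Lemma rweak0_const u : rweak 1 u (fun=> 0) -> exists c, {ae mu, forall x, u x = c}.
Proof.
move=> [ui _ u0]; apply: du_Bois_Reymond => // phi tphi.
have := u0 _ tphi; rewrite derive1n1 => ->.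
by under eq_Rintegral do rewrite mul0r; rewrite Rintegral_cst// mul0r mulr0.
Qed.

End real_weak_derivative.

Section weak_primitive.
Context {R : realType}.
Implicit Types (H k phi : R -> R).
Local Notation mu := (@lebesgue_measure R).

(** This increment form covers at once the primitives taken from - oo and those
    taken from + oo, without normalization at a base point. *)
Definition primitive_of k H := forall x y : R, x <= y ->
  H y - H x = \int[mu]_(t in `[x, y]) k t.

Lemma primitive_continuous k H : locally_integrable setT k ->
  primitive_of k H -> continuous H.
Proof.
move=> ki Hk x.
have x1 : x - 1 < x + 1 by rewrite ltrD2l; lra.
have /continuous_within_itvP := parameterized_integral_continuous (ltW x1)
  (locally_integrable_itv (x - 1) (x + 1) ki).
move=> /(_ x1)[+ _ _] => /(_ x); rewrite in_itv/= gtrBl ltrDl ltr01 => /(_ isT).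
move=> /(@cvgD _ _ _ _ _ _ _ _ _ (cvg_cst (H (x - 1)))).
rewrite /parameterized_integral => cH.
apply: cvg_trans; last first.
  rewrite (_ : H x = H (x - 1) + \int[mu]_(t in `[x - 1, x]) k t); first exact: cH.
  by rewrite -Hk ?gerBl// addrCA subrr addr0.
apply: near_eq_cvg; near=> z.
rewrite -[LHS]/(H (x - 1) + \int[mu]_(t in `[x - 1, z]) k t) -Hk.
  by rewrite addrCA subrr addr0.
by apply: ltW; near: z; apply: lt_nbhsr; rewrite gtrBl.
Unshelve. all: by end_near. Qed.

(** Take phi supported in [-M, M].  Since phi' has integral zero, H may be
    replaced by H - H (- M), which on [-M, M] is the integral of k over [-M, x].
    Fubini's theorem exchanges the two integrations, and the inner integral
    becomes that of phi' over [y, +oo[, namely - phi y. *)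
Lemma rweak_primitive k H : locally_integrable setT k -> primitive_of k H ->
  rweak 1 H k.
Proof.
move=> ki Hk; have cH := primitive_continuous ki Hk.
have iH : locally_integrable setT H.
  apply: locally_integrable_of_itv; first exact: continuous_measurable_fun.
  move=> a b; apply: continuous_compact_integrable; first exact: segment_compact.
  exact: continuous_subspaceT.
split => // phi tphi; rewrite derive1n1 expr1 mulN1r.
have tdphi := test_derive1 tphi.
have [M M0 phiM] := test_supp tphi.
have dphiM := vanishes_derive1 phiM.
pose kM := k \_ `[- M, M].
have kMi : mu.-integrable setT (EFin \o kM).
  by have /integrable_mkcond := locally_integrable_itv (- M) M ki; rewrite restrict_EFin; apply.
pose F (z : R * R) : \bar R := (if z.2 <= z.1 then kM z.2 * derive1 phi z.1 else 0)%:E.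
have mF : measurable_fun setT F.
  apply/measurable_EFinP; apply: measurable_fun_ifT => //=.
    by apply: measurable_fun_ler; [exact: measurable_snd|exact: measurable_fst].
  apply: measurable_funM.
    apply: measurableT_comp; last exact: measurable_snd.
    by apply/measurable_EFinP; case/integrableP : kMi.
  apply: measurableT_comp; last exact: measurable_fst.
  exact: test_measurable.
have iF : (mu \x mu)%E.-integrable setT F.
  have [_] := @integrable12ltyP _ _ _ _ R mu mu F mF; apply.
  pose K := (\int[mu]_y `|(EFin \o kM) y|)%E.
  have Kfin : K \is a fin_num by apply: integrable_fin_num => //; exact: integrable_abse.
  apply: (@le_lt_trans _ _ (\int[mu]_x (`|derive1 phi x|%:E * K)))%E.
    apply: ge0_le_integral => //.
    - by move=> x _; apply: integral_ge0.
    - apply: (@measurable_fun_fubini_tonelli_F _ _ _ _ R mu (fun z => `|F z|%E)) => //.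
      exact: measurableT_comp.
    - apply: emeasurable_funM => //.
      by apply/measurable_EFinP/measurableT_comp => //; exact: test_measurable.
    - move=> x _; rewrite /K -ge0_integralZl//; last first.
        by apply: measurableT_comp => //; case/integrableP : kMi.
      apply: ge0_le_integral => //.
      + apply: measurableT_comp => //.
        exact: (measurableT_comp mF (pair1_measurable x)).
      + apply: emeasurable_funM => //.
        by apply: measurableT_comp => //; case/integrableP : kMi.
      + move=> y _; rewrite /F /=; case: ifP => _; last by rewrite normr0 mule_ge0.
        by rewrite -EFinM lee_fin normrM mulrC.
  rewrite -(fineK Kfin) ge0_integralZr//; last 2 first.
  - by apply/measurable_EFinP/measurableT_comp => //; exact: test_measurable.
  - by rewrite lee_fin fine_ge0// integral_ge0.
  apply: lte_mul_pinfty; first exact: integral_ge0.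
    rewrite ge0_fin_numE; last exact: integral_ge0.
    by have /integrableP[] := integrable_test tdphi.
  exact: ltry.
have E1 : (\int[mu]_x \int[mu]_y F (x, y) = \int[mu]_x ((H x - H (- M)) * derive1 phi x)%:E)%E.
  apply: eq_integral => x _.
  (* beyond M both sides vanish with phi' *)
  have [Mx|xM] := ltP M `|x|.
    rewrite dphiM// mulr0 integral0_eq// => y _; rewrite /F /= dphiM// mulr0.
    by case: ifP.
  move: xM; rewrite ler_norml => /andP[Mx xM].
  rewrite Hk// EFinM /Rintegral fineK; last first.
    by apply: integrable_fin_num => //; exact: locally_integrable_itv.
  rewrite -integralZr//; last exact: locally_integrable_itv.
  rewrite [RHS]integral_mkcond; apply: eq_integral => y _.
  rewrite /F /kM /= !patchE !mem_setE !in_itv/=.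
  have [yx|xy] := leP y x; last by rewrite andbF.
  by rewrite (le_trans yx xM); case: ifP; rewrite ?mul0r.
have E2 : (\int[mu]_y \int[mu]_x F (x, y) = \int[mu]_y (- (k y * phi y))%:E)%E.
  apply: eq_integral => y _.
  transitivity (\int[mu]_(x in `[y, +oo[) ((kM y)%:E * (derive1 phi x)%:E))%E.
    rewrite [RHS]integral_mkcond; apply: eq_integral => x _.
    by rewrite patchE /F/= mem_setE in_itv/= andbT; case: ifP; rewrite ?mul0r.
  have idphi : mu.-integrable `[y, +oo[ (EFin \o derive1 phi).
    by apply: integrableS (integrable_test tdphi).
  rewrite integralZl//.
  rewrite -[X in (_ * X)%E]fineK; last exact: integrable_fin_num.
  rewrite -[X in (_ * X%:E)%E]/(\int[mu]_(x in `[y, +oo[) derive1 phi x).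
  rewrite integral_test_tail// -EFinM mulrN /kM patchE; case: ifPn => //.
  rewrite notin_setE/= in_itv/= -ler_norml => /negP; rewrite -ltNge => My.
  by rewrite phiM// !mulr0.
have HE : \int[mu]_x ((H x - H (- M)) * derive1 phi x) = \int[mu]_y (- (k y * phi y)).
  by congr fine; exact: etrans (esym E1) (etrans (Fubini iF) E2).
have iHp := integrable_mul_test iH tdphi.
transitivity (\int[mu]_x ((H x - H (- M)) * derive1 phi x)).
  under [RHS]eq_Rintegral do rewrite mulrBl.
  rewrite RintegralB//; last by apply: integrable_test; exact: testZ.
  rewrite RintegralZl//; last exact: integrable_test.
  by rewrite integral_test_derive1// mulr0 subr0.
rewrite HE; under eq_Rintegral do rewrite -mulN1r.
by rewrite RintegralZl ?mulN1r//; exact: integrable_mul_test.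
Qed.

End weak_primitive.

(** * Square-integrable functions and the Schur test *)

Section square_integrable.
Context {R : realType}.
Implicit Types (g h u v chi : R -> R) (c : R).
Local Notation mu := (@lebesgue_measure R).

(** The square of the L^2 norm.  Bounds are stated for it rather than for the
    norm, which keeps them free of roots of extended reals. *)
Definition energy g : \bar R := (\int[mu]_x (g x ^+ 2)%:E)%E.

Definition L2 g : Prop := measurable_fun setT g /\ (energy g < +oo)%E.

Lemma energy_ge0 g : (0 <= energy g)%E.
Proof. by apply: integral_ge0 => x _; rewrite lee_fin sqr_ge0. Qed.

Lemma measurable_sqr g : measurable_fun setT g ->
  measurable_fun setT (fun x => (g x ^+ 2)%:E).
Proof. by move=> mg; apply/measurable_EFinP; exact: measurable_funX. Qed.

Lemma L2_locally_integrable g : L2 g -> locally_integrable setT g.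
Proof.
move=> [mg ig]; apply: locally_integrable_of_itv => // a b.
apply: (@le_integrable _ _ _ mu `[a, b] (measurable_itv _) _
  (EFin \o (fun x => 1 + g x ^+ 2))) => //.
- exact/measurable_EFinP/measurable_funTS.
- move=> x _ /=; rewrite lee_fin [leRHS]ger0_norm ?addr_ge0 ?sqr_ge0//.
  by rewrite -[g x ^+ 2]real_normK ?num_real//; have := normr_ge0 (g x); nra.
- rewrite (_ : EFin \o _ = (EFin \o cst (1 : R)%R) \+ (fun x => (g x ^+ 2)%:E))%E//.
  apply: integrableD => //.
  + apply: continuous_compact_integrable; first exact: segment_compact.
    by apply: continuous_subspaceT => x; exact: cvg_cst.
  + apply: (@integrableS _ _ _ _ setT) => //; apply/integrableP; split.
      exact: measurable_sqr.
    by under eq_integral do rewrite gee0_abs ?lee_fin ?sqr_ge0//.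
Qed.

(** Cauchy-Schwarz for the measure K dy, in the form that the Schur test needs.
    It follows from |h| <= h^2 / (2 s) + s / 2 at s = V / A, which reads
    V <= A B / (2 V) + V / 2 after integration, B being the integral on the
    right. *)
Lemma weighted_Cauchy_Schwarz (K h : R -> R) (A V : R) : 0 < A -> 0 <= V ->
  measurable_fun setT K -> measurable_fun setT h -> (forall y, 0 <= K y) ->
  (\int[mu]_y (K y)%:E <= A%:E)%E ->
  (V%:E <= \int[mu]_y (K y * `|h y|)%:E)%E ->
  ((V ^+ 2)%:E <= A%:E * \int[mu]_y (K y * h y ^+ 2)%:E)%E.
Proof.
move=> A0 V0 mK mh K0 KA VK.
have mKh2 : measurable_fun setT (fun y => (K y * h y ^+ 2)%:E).
  by apply/measurable_EFinP/measurable_funM => //; exact: measurable_funX.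
set B := (\int[mu]_y (K y * h y ^+ 2)%:E)%E.
have B0 : (0 <= B)%E by apply: integral_ge0 => y _; rewrite lee_fin mulr_ge0// sqr_ge0.
have [->|Vn0] := eqVneq V 0; first by rewrite expr0n/= mule_ge0// lee_fin ltW.
have {Vn0}{}V0 : 0 < V by rewrite lt_neqAle eq_sym Vn0.
(* the value of s that minimizes the bound below when B = V^2 / A *)
pose s := V / A; have s0 : 0 < s by rewrite divr_gt0.
have : (V%:E <= ((2 * s)^-1)%:E * B + (s / 2)%:E * A%:E)%E.
  apply: (le_trans VK).
  apply: (@le_trans _ _ (((2 * s)^-1)%:E * B + (s / 2)%:E * \int[mu]_y (K y)%:E))%E; last first.
    by rewrite leeD2l// lee_wpmul2l// lee_fin divr_ge0// ltW.
  rewrite -!ge0_integralZl//; last 5 first.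
  - exact/measurable_EFinP.
  - by move=> y _; rewrite lee_fin.
  - by rewrite lee_fin divr_ge0// ltW.
  - by move=> y _; rewrite lee_fin mulr_ge0// sqr_ge0.
  - by rewrite lee_fin invr_ge0 mulr_ge0// ltW.
  have c1 : 0 <= (2 * s)^-1 by rewrite invr_ge0 mulr_ge0// ltW.
  have c2 : 0 <= s / 2 by rewrite divr_ge0// ltW.
  rewrite -ge0_integralD//; last 4 first.
  - move=> y _; rewrite -EFinM lee_fin; apply: mulr_ge0 => //.
    by apply: mulr_ge0 => //; exact: sqr_ge0.
  - exact: measurable_funeM.
  - by move=> y _; rewrite -EFinM lee_fin mulr_ge0.
  - by apply: measurable_funeM; exact/measurable_EFinP.
  apply: ge0_le_integral => //.
  - by move=> y _; rewrite lee_fin mulr_ge0.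
  - by apply/measurable_EFinP/measurable_funM => //; exact: measurableT_comp.
  - apply: emeasurable_funD; apply: measurable_funeM => //.
    exact/measurable_EFinP.
  - move=> y _; rewrite -!EFinM -EFinD lee_fin /=.
    rewrite mulrCA [s / 2 * _]mulrC -mulrDr ler_wpM2l//.
    rewrite -[h y ^+ 2]real_normK ?num_real// -subr_ge0.
    rewrite (_ : _ - _ = (`|h y| - s) ^+ 2 / (2 * s)).
      by rewrite divr_ge0 ?sqr_ge0// mulr_ge0// ltW.
    by field; rewrite gt_eqF.
have [Bfin|] := boolP (B \is a fin_num); last first.
  by rewrite ge0_fin_numE// -leNgt leye_eq => /eqP -> _; rewrite gt0_muley// ?lte_fin// leey.
rewrite -(fineK Bfin) -!EFinM -EFinD !lee_fin; set r := fine B => Vr.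
have : V / 2 <= A * r / (2 * V).
  have := Vr; rewrite /s -subr_ge0.
  have -> : (2 * (V / A))^-1 * r + V / A / 2 * A - V = A * r / (2 * V) - V / 2.
    by field; rewrite !gt_eqF.
  by rewrite subr_ge0.
rewrite ler_pdivlMr ?mulr_gt0//.
by congr (_ <= _); field.
Qed.

(** Apply Cauchy-Schwarz to each v x with respect to the weight K (x, _),
    integrate in x, and exchange the integrals: each of the two marginals
    contributes a factor A. *)
Lemma Schur_test (K : R * R -> R) (A : R) h v : 0 < A ->
  measurable_fun setT K -> (forall z, 0 <= K z) ->
  (forall x, \int[mu]_y (K (x, y))%:E <= A%:E)%E ->
  (forall y, \int[mu]_x (K (x, y))%:E <= A%:E)%E ->
  measurable_fun setT h -> measurable_fun setT v ->
  (forall x, `|v x|%:E <= \int[mu]_y (K (x, y) * `|h y|)%:E)%E ->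
  (energy v <= (A ^+ 2)%:E * energy h)%E.
Proof.
move=> A0 mK K0 Kx Ky mh mv vK.
have mKx x : measurable_fun setT (fun y => K (x, y)).
  exact: (measurableT_comp mK (pair1_measurable x)).
have mKy y : measurable_fun setT (fun x => K (x, y)).
  exact: (measurableT_comp mK (pair2_measurable y)).
pose G (z : R * R) := (K z * h z.2 ^+ 2)%:E.
have mG : measurable_fun setT G.
  apply/measurable_EFinP/measurable_funM => //; apply: measurable_funX.
  by apply: measurableT_comp => //; exact: measurable_snd.
have G0 z : (0 <= G z)%E by rewrite lee_fin mulr_ge0// sqr_ge0.
apply: (@le_trans _ _ (\int[mu]_x (A%:E * \int[mu]_y G (x, y))))%E.
  apply: ge0_le_integral => //.
  - by move=> x _; rewrite lee_fin sqr_ge0.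
  - exact: measurable_sqr.
  - by apply: measurable_funeM; exact: (@measurable_fun_fubini_tonelli_F _ _ _ _ R mu).
  - move=> x _; rewrite -[v x ^+ 2]real_normK ?num_real//.
    exact: weighted_Cauchy_Schwarz.
rewrite ge0_integralZl//; last 3 first.
- exact: (@measurable_fun_fubini_tonelli_F _ _ _ _ R mu).
- by move=> x _; exact: integral_ge0.
- by rewrite lee_fin ltW.
rewrite (@fubini_tonelli _ _ _ _ R mu mu G)// expr2 EFinM -muleA.
rewrite lee_wpmul2l ?lee_fin ?(ltW A0)// /energy -ge0_integralZl//; last 3 first.
- exact: measurable_sqr.
- by move=> x _; rewrite lee_fin sqr_ge0.
- by rewrite lee_fin ltW.
apply: ge0_le_integral => //.
- by move=> y _; exact: integral_ge0.
- exact: (@measurable_fun_fubini_tonelli_G _ _ _ _ R mu).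
- by apply: measurable_funeM; exact: measurable_sqr.
- move=> y _; rewrite /G /=.
  under eq_integral do rewrite EFinM.
  rewrite ge0_integralZr//.
  + by rewrite lee_wpmul2r// lee_fin sqr_ge0.
  + by apply/measurable_EFinP; exact: mKy.
  + by move=> x _; rewrite lee_fin.
  + by rewrite lee_fin sqr_ge0.
Qed.

End square_integrable.

(** * The equation v' = c v + h with c nonzero *)

Section exponential_kernel.
Context {R : realType}.
Implicit Types (h k v : R -> R) (c : R).
Local Notation mu := (@lebesgue_measure R).

Lemma smooth_expRZ c : smooth (fun x : R => expR (c * x)).
Proof.
have := @smooth_affine R expR c 0 smooth_expR; congr smooth.
by apply/funext => x; rewrite addr0.
Qed.

Lemma derive1_expRZ c : derive1 (fun x : R => expR (c * x)) = fun x => c * expR (c * x).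
Proof.
apply/funext => x; rewrite derive1E.
have ? : is_derive x 1 (fun y : R => expR (c * y)) (expR (c * x) * c).
  apply: (is_derive1_comp (f := expR) (g := fun y => c * y)).
  by apply: is_derive_eq; rewrite /GRing.scale/= mulr1.
by rewrite derive_val mulrC.
Qed.

Lemma integral_expR_right c (y : R) : 0 < c ->
  (\int[mu]_(x in `[y, +oo[) (expR (- (c * (x - y))))%:E = c^-1%:E)%E.
Proof.
move=> c0; pose F (x : R) := (- c^-1 * expR (c * y)) * expR (- c * x).
have sF : smooth F by apply: smoothZ; exact: smooth_expRZ.
have dF x : derive1 F x = expR (- (c * (x - y))).
  have ? := smooth_is_derive x (@smooth_expRZ (- c)).
  rewrite derive1E (@derive_val _ _ _ _ _ _ _ (is_deriveZ _ _)) derive1_expRZ.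
  rewrite (_ : - (c * (x - y)) = c * y + - c * x); last by ring.
  by rewrite expRD /GRing.scale/=; field; rewrite gt_eqF.
rewrite (@ge0_continuous_FTC2y _ _ F y 0).
- rewrite /F sub0e -EFinN; congr EFin.
  by rewrite -mulrA -expRD (mulNr c) subrr expR0 mulr1 opprK.
- by move=> x _; exact: expR_ge0.
- rewrite (_ : (fun x => _) = derive1 F); last by apply/funext => x; rewrite dF.
  by apply: continuous_subspaceT; exact/smooth_continuous/smooth_derive1.
- have e0 : expR (- c * x) @[x --> +oo] --> (0 : R).
    rewrite (_ : (fun x => _) = (fun x => expR (- x)) \o (fun x => c * x)).
      by apply: cvg_comp; [exact: (gt0_cvgMry c0)|exact: cvgr_expR].
    by apply/funext => x; rewrite /= mulNr.
  have : F x @[x --> +oo] --> (- c^-1 * expR (c * y)) * 0.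
    by apply: cvgM; [exact: cvg_cst|exact: e0].
  by rewrite mulr0.
- by move=> x _; exact: smooth_derivable.
- exact/cvg_at_right_filter/smooth_continuous.
- by move=> x _; rewrite dF.
Qed.

Lemma integral_expR_left c (x : R) : 0 < c ->
  (\int[mu]_(y in `]-oo, x]) (expR (- (c * (x - y))))%:E = c^-1%:E)%E.
Proof.
move=> c0; rewrite -[X in `]-oo, X]](opprK x) ge0_integration_by_substitutionNy.
- rewrite -(integral_expR_right (- x) c0); apply: eq_integral => y _ /=.
  by rewrite !opprK addrC.
- rewrite (_ : (fun y : R => expR (- (c * (x - y)))) =
               fun y => expR (- (c * x)) * expR (c * y)).
    apply: continuous_subspaceT; apply: smooth_continuous; apply: smoothZ.
    exact: smooth_expRZ.
  by apply/funext => y; rewrite -expRD; congr expR; ring.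
- by move=> y _; exact: expR_ge0.
Qed.

(** The Green function of v' = - c v + h, for c > 0; exchanging its arguments
    and the sign gives that of v' = c v + h. *)
Definition exp_kernel c (z : R * R) : R :=
  if z.2 <= z.1 then expR (- (c * (z.1 - z.2))) else 0.

Lemma exp_kernel_ge0 c z : 0 <= exp_kernel c z.
Proof. by rewrite /exp_kernel; case: ifP => // _; exact: expR_ge0. Qed.

Lemma measurable_exp_kernel c : measurable_fun setT (exp_kernel c).
Proof.
apply: measurable_fun_ifT => //=.
  by apply: measurable_fun_ler; [exact: measurable_snd|exact: measurable_fst].
apply: measurableT_comp => //; apply: measurableT_comp => //.
apply: measurable_funM => //; apply: measurable_funB.
  exact: measurable_fst.
exact: measurable_snd.
Qed.

Lemma exp_kernelE1 c (x : R) (g : R -> R) :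
  (\int[mu]_y (exp_kernel c (x, y) * g y)%:E =
   \int[mu]_(y in `]-oo, x]) (expR (- (c * (x - y))) * g y)%:E)%E.
Proof.
rewrite [RHS]integral_mkcond; apply: eq_integral => y _.
by rewrite patchE mem_setE in_itv/= /exp_kernel/=; case: ifP; rewrite ?mul0r.
Qed.

Lemma exp_kernelE2 c (y : R) (g : R -> R) :
  (\int[mu]_x (exp_kernel c (x, y) * g x)%:E =
   \int[mu]_(x in `[y, +oo[) (expR (- (c * (x - y))) * g x)%:E)%E.
Proof.
rewrite [RHS]integral_mkcond; apply: eq_integral => x _.
by rewrite patchE mem_setE in_itv/= andbT /exp_kernel/=; case: ifP; rewrite ?mul0r.
Qed.

Lemma integral_exp_kernel1 c (x : R) : 0 < c ->
  (\int[mu]_y (exp_kernel c (x, y))%:E = c^-1%:E)%E.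
Proof.
move=> c0; rewrite -(integral_expR_left x c0).
have := exp_kernelE1 c x (cst 1).
under eq_integral do rewrite mulr1.
by under [X in _ = X -> _]eq_integral do rewrite mulr1.
Qed.

Lemma integral_exp_kernel2 c (y : R) : 0 < c ->
  (\int[mu]_x (exp_kernel c (x, y))%:E = c^-1%:E)%E.
Proof.
move=> c0; rewrite -(integral_expR_right y c0).
have := exp_kernelE2 c y (cst 1).
under eq_integral do rewrite mulr1.
by under [X in _ = X -> _]eq_integral do rewrite mulr1.
Qed.

End exponential_kernel.

Section solve_real.
Context {R : realType}.
Implicit Types (h k v w : R -> R) (c : R).
Local Notation mu := (@lebesgue_measure R).

(** Since |h| <= 1 + h^2, a bounded integrable weight makes an L^2 function
    integrable. *)
Lemma integrable_weight_L2 (D : set (measurableTypeR R)) w h (C : R) : measurable D ->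
  mu.-integrable D (EFin \o w) -> (forall x, D x -> 0 <= w x <= C) -> L2 h ->
  mu.-integrable D (EFin \o (w \* h)).
Proof.
move=> mD wi wC [mh ih]; have mw : measurable_fun D w.
  by apply/measurable_EFinP; case/integrableP : wi.
have ih2 : mu.-integrable D (fun x => (C%:E * (h x ^+ 2)%:E)%E).
  apply: integrableZl => //; apply: (@integrableS _ _ _ _ setT) => //.
  apply/integrableP; split; first exact: measurable_sqr.
  by under eq_integral do rewrite gee0_abs ?lee_fin ?sqr_ge0//.
have ig := integrableD mD wi ih2.
apply: (@le_integrable _ _ _ mu D mD _ _ _ _ ig).
  by apply/measurable_EFinP; apply: measurable_funM => //; exact: measurable_funTS.
move=> x Dx; have /andP[w0 wx] := wC _ Dx.
rewrite /= lee_fin [leRHS]ger0_norm; last first.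
  by rewrite addr_ge0// mulr_ge0 ?sqr_ge0// (le_trans w0).
rewrite normrM (ger0_norm w0).
apply: (@le_trans _ _ (w x + w x * h x ^+ 2)).
  rewrite -[h x ^+ 2]real_normK ?num_real// -[X in X + _]mulr1 -mulrDr ler_wpM2l//.
  by have := sqr_ge0 (`|h x| - 1); have := normr_ge0 (h x); nra.
by rewrite lerD2l ler_wpM2r// sqr_ge0.
Qed.

Lemma primitive_left k : (forall x : R, mu.-integrable `]-oo, x] (EFin \o k)) ->
  primitive_of k (fun x => \int[mu]_(t in `]-oo, x]) k t).
Proof.
move=> ki x y xy; rewrite (Rintegral_itvB (ki y))//.
apply: Rintegral_itv_obnd_cbnd; apply: integrableS (ki y) => //.
exact: subset_itvr.
Qed.

Lemma primitive_right k : (forall x : R, mu.-integrable `[x, +oo[ (EFin \o k)) ->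
  primitive_of k (fun x => - \int[mu]_(t in `[x, +oo[) k t).
Proof.
move=> ki x y xy; rewrite opprK addrC; apply/eqP; rewrite subr_eq addrC -subr_eq.
rewrite (@Rintegral_itvB _ k (BLeft x) +oo%O y) ?bnd_simp//.
apply/eqP/Rintegral_itv_obnd_cbnd; apply: integrableS (ki x) => //.
by apply: subset_itvr; rewrite bnd_simp.
Qed.

(** Variation of constants: v is exp (- c x) times the integral of
    exp (c y) h y over ]-oo, x], which converges thanks to the decay of
    exp (c y) at - oo. *)
Lemma solve_real_neg c h : 0 < c -> L2 h -> exists v, [/\ L2 v,
  rweak 1 v (fun x => - c * v x + h x) & (energy v <= (c^-1 ^+ 2)%:E * energy h)%E].
Proof.
move=> c0 Lh; have [mh ih] := Lh.
pose k (x : R) := expR (c * x) * h x.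
have mk : measurable_fun setT k.
  by apply: measurable_funM => //; apply: smooth_measurable; exact: smooth_expRZ.
have ki (x : R) : mu.-integrable `]-oo, x] (EFin \o k).
  apply: (@integrable_weight_L2 _ _ _ (expR (c * x))) => //.
    apply/integrableP; split.
      apply/measurable_EFinP; apply: measurable_funTS; apply: smooth_measurable.
      exact: smooth_expRZ.
    under eq_integral => y _.
      rewrite gee0_abs ?lee_fin ?expR_ge0//=.
      rewrite (_ : c * y = c * x + - (c * (x - y))); last by ring.
      rewrite expRD EFinM; over.
    rewrite ge0_integralZl//.
    - by rewrite integral_expR_left// -EFinM ltry.
    - rewrite (_ : (fun y => _) = EFin \o (fun y => expR (- (c * x)) * expR (c * y))).
        apply/measurable_EFinP; apply: measurable_funTS; apply: smooth_measurable.
        by apply: smoothZ; exact: smooth_expRZ.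
      by apply/funext => y /=; rewrite -expRD; congr (expR _)%:E; ring.
  by move=> y; rewrite /= in_itv/= => yx; rewrite expR_ge0 ler_expR ler_pM2l.
have kloc : locally_integrable setT k.
  apply: locally_integrable_of_itv => // a b; apply: integrableS (ki b) => //.
  exact: subset_itvr.
pose H (x : R) := \int[mu]_(t in `]-oo, x]) k t.
have Hk : primitive_of k H := primitive_left ki.
have wH := rweak_primitive kloc Hk.
pose v x := expR (- c * x) * H x.
have wv : rweak 1 v (fun x => - c * v x + h x).
  have := rweakM (@smooth_expRZ R (- c)) wH; congr rweak.
  apply/funext => x /=; rewrite derive1_expRZ -mulrA; congr (_ + _).
  by rewrite /k mulrA -expRD mulNr addNr expR0 mul1r.
have mv : measurable_fun setT v by case: wv => -[].
have ev : (energy v <= (c^-1 ^+ 2)%:E * energy h)%E.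
  apply: (Schur_test (K := exp_kernel c)) => //.
  - by rewrite invr_gt0.
  - exact: measurable_exp_kernel.
  - exact: exp_kernel_ge0.
  - by move=> x; rewrite integral_exp_kernel1.
  - by move=> y; rewrite integral_exp_kernel2.
  - move=> x; rewrite exp_kernelE1 normrM ger0_norm ?expR_ge0// EFinM.
    rewrite EFin_normr_Rintegral//.
    apply: (@le_trans _ _ ((expR (- c * x))%:E * \int[mu]_(t in `]-oo, x]) `|(k t)%:E|)%E).
      rewrite lee_wpmul2l ?lee_fin ?expR_ge0//; apply: le_abse_integral => //.
      by case/integrableP : (ki x).
    rewrite -ge0_integralZl//; last first.
      by apply: measurableT_comp => //; case/integrableP : (ki x).
    rewrite le_eqVlt; apply/orP; left; apply/eqP; apply: eq_integral => y _.
    rewrite -EFinM /k normrM ger0_norm ?expR_ge0// mulrA -expRD.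
    by congr (expR _ * _)%:E; ring.
exists v; split => //; split => //; apply: le_lt_trans ev _.
by apply: lte_mul_pinfty; rewrite ?lee_fin ?sqr_ge0.
Qed.

End solve_real.

Section solve_real2.
Context {R : realType}.
Implicit Types (f h k v w : R -> R) (c : R).
Local Notation mu := (@lebesgue_measure R).

(** The growing exponential has to be integrated from + oo, where exp (- c y)
    decays. *)
Lemma solve_real_pos c h : 0 < c -> L2 h -> exists v, [/\ L2 v,
  rweak 1 v (fun x => c * v x + h x) & (energy v <= (c^-1 ^+ 2)%:E * energy h)%E].
Proof.
move=> c0 Lh; have [mh ih] := Lh.
pose k (x : R) := expR (- c * x) * h x.
have mk : measurable_fun setT k.
  by apply: measurable_funM => //; apply: smooth_measurable; exact: smooth_expRZ.
have ki (x : R) : mu.-integrable `[x, +oo[ (EFin \o k).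
  apply: (@integrable_weight_L2 _ _ _ _ (expR (- c * x))) => //.
    apply/integrableP; split.
      apply/measurable_EFinP; apply: measurable_funTS; apply: smooth_measurable.
      exact: smooth_expRZ.
    under eq_integral => y _.
      rewrite gee0_abs ?lee_fin ?expR_ge0//=.
      rewrite (_ : - c * y = - c * x + - (c * (y - x))); last by ring.
      rewrite expRD EFinM; over.
    rewrite ge0_integralZl//.
    - by rewrite integral_expR_right// -EFinM ltry.
    - rewrite (_ : (fun y => _) = EFin \o (fun y => expR (c * x) * expR (- c * y))).
        apply/measurable_EFinP; apply: measurable_funTS; apply: smooth_measurable.
        by apply: smoothZ; exact: smooth_expRZ.
      by apply/funext => y /=; rewrite -expRD; congr (expR _)%:E; ring.
  move=> y; rewrite /= in_itv/= andbT => xy.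
  by rewrite expR_ge0 ler_expR ler_nM2l// oppr_lt0.
have kloc : locally_integrable setT k.
  apply: locally_integrable_of_itv => // a b; apply: integrableS (ki a) => //.
  exact: subset_itvl.
pose H (x : R) := - \int[mu]_(t in `[x, +oo[) k t.
have Hk : primitive_of k H := primitive_right ki.
have wH := rweak_primitive kloc Hk.
pose v x := expR (c * x) * H x.
have wv : rweak 1 v (fun x => c * v x + h x).
  have := rweakM (@smooth_expRZ R c) wH; congr rweak.
  apply/funext => x /=; rewrite derive1_expRZ -mulrA; congr (_ + _).
  by rewrite /k mulrA -expRD mulNr subrr expR0 mul1r.
have mv : measurable_fun setT v by case: wv => -[].
have ev : (energy v <= (c^-1 ^+ 2)%:E * energy h)%E.
  apply: (Schur_test (K := fun z => exp_kernel c (z.2, z.1))) => //.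
  - by rewrite invr_gt0.
  - apply: measurableT_comp; first exact: measurable_exp_kernel.
    exact: measurable_swap.
  - by move=> z; exact: exp_kernel_ge0.
  - by move=> x; rewrite integral_exp_kernel2.
  - by move=> y; rewrite integral_exp_kernel1.
  - move=> x; rewrite exp_kernelE2 normrM normrN ger0_norm ?expR_ge0// EFinM.
    rewrite EFin_normr_Rintegral//.
    apply: (@le_trans _ _ ((expR (c * x))%:E * \int[mu]_(t in `[x, +oo[) `|(k t)%:E|)%E).
      rewrite lee_wpmul2l ?lee_fin ?expR_ge0//; apply: le_abse_integral => //.
      by case/integrableP : (ki x).
    rewrite -ge0_integralZl//; last first.
      by apply: measurableT_comp => //; case/integrableP : (ki x).
    rewrite le_eqVlt; apply/orP; left; apply/eqP; apply: eq_integral => y _.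
    rewrite -EFinM /k normrM ger0_norm ?expR_ge0// mulrA -expRD.
    by congr (expR _ * _)%:E; ring.
exists v; split => //; split => //; apply: le_lt_trans ev _.
by apply: lte_mul_pinfty; rewrite ?lee_fin ?sqr_ge0.
Qed.

Lemma solve_real c h : c != 0 -> L2 h -> exists v, [/\ L2 v,
  rweak 1 v (fun x => c * v x + h x) & (energy v <= (c^-1 ^+ 2)%:E * energy h)%E].
Proof.
rewrite neq_lt => /orP[c0|c0] Lh; last exact: solve_real_pos.
have := @solve_real_neg R (- c) h; rewrite oppr_gt0 => /(_ c0 Lh).
by rewrite opprK invrN sqrrN.
Qed.

End solve_real2.

(** * The equation v' = f for data with a first moment *)

Section moment.
Context {R : realType}.
Implicit Types (f h k v w : R -> R) (c : R).
Local Notation mu := (@lebesgue_measure R).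

Definition moment f (x : R) : R := x * f x.

(** The part of f that the first moment does not control. *)
Definition cutoff f (x : R) : R := \1_`[- 1, 1] x * f x.

Lemma abs_le_moment f (x : R) : `|f x| <= `|moment f x| + `|cutoff f x|.
Proof.
rewrite /cutoff indicE mem_setE in_itv/= -ler_norml; have [x1|x1] := leP `|x| 1.
  by rewrite mul1r lerDr.
by rewrite mul0r normr0 addr0 normrM ler_peMl// ltW.
Qed.

Lemma integrable_cutoff f : L2 f -> mu.-integrable setT (EFin \o cutoff f).
Proof.
move=> Lf; have := locally_integrable_itv (- 1) 1 (L2_locally_integrable Lf).
move=> /integrable_mkcond => /(_ (measurable_itv _)).
apply: eq_integrable => // x _.
by rewrite patchE /= /cutoff indicE; case: ifP => _; rewrite ?mul1r ?mul0r.
Qed.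

Lemma integrable_moment f : L2 f -> mu.-integrable setT (EFin \o moment f) ->
  mu.-integrable setT (EFin \o f).
Proof.
move=> Lf mf; have [mf' _] := Lf.
apply: (@le_integrable _ _ _ mu _ measurableT _ _ _ _ (integrableD measurableT
  (integrable_abse mf) (integrable_abse (integrable_cutoff Lf)))).
  exact/measurable_EFinP.
move=> x _ /=; rewrite lee_fin [leRHS]ger0_norm; first exact: abs_le_moment.
by rewrite addr_ge0.
Qed.

(** Cauchy-Schwarz on [-1, 1], an interval of length 2. *)
Lemma mass_cutoff f : L2 f -> (\int[mu]_x `|cutoff f x|) ^+ 2 <= 2 * fine (energy f).
Proof.
move=> Lf; have [mf ef] := Lf.
have ic := integrable_cutoff Lf.
have efin : energy f \is a fin_num by rewrite ge0_fin_numE// energy_ge0.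
rewrite -lee_fin [leRHS]EFinM fineK//.
have m1 : measurable_fun setT (\1_`[- 1, 1] : R -> R) by exact: measurable_indic.
apply: le_trans.
  apply: (@weighted_Cauchy_Schwarz R (\1_`[- 1, 1]) f 2
    (\int[mu]_x `|cutoff f x|)) => //.
  - by apply: Rintegral_ge0.
  - rewrite integral_indic// setIT -[leLHS]/(mu `[- 1, 1]) lebesgue_measure_itv/= lte_fin.
    by rewrite gtrN// -EFinD opprK lee_fin -natr1.
  - rewrite fineK; last first.
      apply: integrable_fin_num => //; exact: (integrable_norm ic).
    rewrite le_eqVlt; apply/orP; left; apply/eqP; apply: eq_integral => x _.
    by rewrite normrM indicE ger0_norm.
- rewrite lee_wpmul2l//; apply: ge0_le_integral => //.
  + by move=> y _; rewrite lee_fin mulr_ge0// ?sqr_ge0// indicE.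
  + by apply/measurable_EFinP/measurable_funM => //; exact: measurable_funX.
  + exact: measurable_sqr.
  + move=> y _; rewrite lee_fin ler_piMl ?sqr_ge0// indicE.
Qed.

Lemma mass_le f : L2 f -> mu.-integrable setT (EFin \o moment f) ->
  \int[mu]_x `|f x| <= \int[mu]_x `|moment f x| + \int[mu]_x `|cutoff f x|.
Proof.
move=> Lf mf; have ic := integrable_cutoff Lf.
have nm := integrable_norm mf; have nc := integrable_norm ic.
rewrite -RintegralD//; apply: le_Rintegral => //.
- exact/integrable_norm/integrable_moment.
- exact: integrableD nm nc.
- by move=> x _; exact: abs_le_moment.
Qed.

(** The integral of |f| is at most the sum of its first absolute moment and of
    its mass on [-1, 1]; the latter is controlled by the L^2 norm. *)
Lemma mean_bound f : L2 f -> mu.-integrable setT (EFin \o moment f) ->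
  (\int[mu]_x f x) ^+ 2 <=
  2 * (\int[mu]_x `|moment f x|) ^+ 2 + 4 * fine (energy f).
Proof.
move=> Lf mf; have := mass_cutoff Lf; have := mass_le Lf mf.
have := le_normr_Rintegral measurableT (integrable_moment Lf mf).
set I := \int[mu]_x f x; set N := \int[mu]_x _; set A := \int[mu]_x _.
set B := \int[mu]_x _; set E := fine _ => IN NAB BE.
have : I ^+ 2 <= (A + B) ^+ 2.
  rewrite -[I ^+ 2]real_normK ?num_real// lerXn2r ?nnegrE//.
    by rewrite (le_trans _ NAB)// (le_trans _ IN).
  exact: le_trans NAB.
by have := sqr_ge0 (A - B); nra.
Qed.

Lemma Rintegral_itv_le f (D : set (measurableTypeR R)) : measurable D ->
  mu.-integrable setT (EFin \o f) ->
  `|\int[mu]_(x in D) f x| <= \int[mu]_x `|f x|.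
Proof.
move=> mD fi; have fD : mu.-integrable D (EFin \o f) by apply: integrableS fi.
apply: (le_trans (le_normr_Rintegral mD fD)).
rewrite -lee_fin !fineK; last 2 first.
- by apply: integrable_fin_num => //; exact: (integrable_norm fi).
- by apply: integrable_fin_num => //; exact: (integrable_norm fD).
apply: ge0_subset_integral => //.
by apply/measurable_EFinP/measurableT_comp => //; case/integrableP : fi => /measurable_EFinP.
Qed.

Lemma integral_oneDsqrV : (\int[mu]_x ((oneDsqr x)^-1)%:E = (pi : R)%:E)%E.
Proof.
rewrite ge0_symfun_integralT//.
- have -> : [set x : R | 0 <= x] = `[0, +oo[%classic.
    by apply/seteqP; split => x /=; rewrite in_itv/= andbT.
  by rewrite integral0y_oneDsqr -EFinM; congr EFin; field.
- exact: continuous_oneDsqrV.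
- by move=> x; rewrite /= /oneDsqr sqrrN.
Qed.

(** The primitive H from - oo is bounded by the mass of f.  Since
    f has mean zero, H x is also minus the integral of f over
    ]x, +oo[, so |x| |H x| is bounded by the first absolute moment whatever the
    sign of x.  Together, (1 + x^2) (H x)^2 is bounded, and 1 / (1 + x^2) has
    integral pi. *)
Lemma solve_zero f : L2 f -> mu.-integrable setT (EFin \o moment f) ->
  \int[mu]_x f x = 0 -> exists v, [/\ L2 v, rweak 1 v f &
  (energy v <= (pi * (3 * (\int[mu]_x `|moment f x|) ^+ 2 + 4 * fine (energy f)))%:E)%E].
Proof.
move=> Lf mf f0; have fi := integrable_moment Lf mf.
have floc := L2_locally_integrable Lf.
pose H (x : R) := \int[mu]_(t in `]-oo, x]) f t.
have Hf : primitive_of f H by apply: primitive_left => x; exact: integrableS fi.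
have wH := rweak_primitive floc Hf.
have mH : measurable_fun setT H by case: wH => -[].
set A := \int[mu]_x `|moment f x|; set E := fine (energy f).
pose B := \int[mu]_x `|cutoff f x|.
have BE : B ^+ 2 <= 2 * E := mass_cutoff Lf.
have HAB x : `|H x| <= A + B.
  by apply: le_trans (mass_le Lf mf); exact: Rintegral_itv_le.
have right x : H x = - \int[mu]_(t in `]x, +oo[) f t.
  apply/eqP; rewrite -subr_eq0 opprK /H -Rintegral_setU//=.
  - rewrite -[X in _ == X]f0; apply/eqP; congr (Rintegral mu _ f).
    by rewrite -itv_bndbnd_setU// set_itvE.
  - by apply: integrableS fi => //; exact: measurableU.
  - apply/disj_set2P/seteqP; split => // t /=; rewrite !in_itv/= andbT => -[tx].
    by rewrite ltNge tx.
have HA x : `|x| * `|H x| <= A.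
  have xint (D : set (measurableTypeR R)) : measurable D ->
      (forall t, D t -> `|x| <= `|t|) ->
      `|x| * `|\int[mu]_(t in D) f t| <= A.
    move=> mD Dx; have fD : mu.-integrable D (EFin \o f) by apply: integrableS fi.
    have ixf : mu.-integrable D (EFin \o (fun t => `|x| * f t)).
      exact: (integrableZl mD `|x| fD).
    rewrite -[`|x|]normr_id -normrM -RintegralZl//.
    apply: (@le_trans _ _ (\int[mu]_(t in D) `|moment f t|)).
      apply: (le_trans (le_normr_Rintegral mD ixf)).
      apply: le_Rintegral => //.
      - exact: (integrable_norm ixf).
      - have nm := integrable_norm mf; by apply: integrableS nm.
      - by move=> t Dt; rewrite !normrM normr_id ler_wpM2r// Dx.
    have := Rintegral_itv_le mD (integrable_norm mf).
    rewrite ger0_norm; last by apply: Rintegral_ge0 => t _; exact: normr_ge0.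
    under [X in _ <= X -> _]eq_Rintegral do rewrite normr_id.
    exact: id.
  have [x0|x0] := leP x 0.
    rewrite /H; apply: xint => // t; rewrite /= in_itv/= => tx.
    by rewrite !ler0_norm ?lerN2// (le_trans tx).
  rewrite right normrN; apply: xint => // t; rewrite /= in_itv/= andbT => xt.
  by rewrite !gtr0_norm ?ltW// (lt_trans x0).
have A0 : 0 <= A by exact: Rintegral_ge0.
have B0 : 0 <= B by exact: Rintegral_ge0.
pose D := 3 * A ^+ 2 + 4 * E.
have E0 : 0 <= E by rewrite fine_ge0// energy_ge0.
have D0 : 0 <= D by rewrite addr_ge0// mulr_ge0// sqr_ge0.
have HD x : H x ^+ 2 <= D * (oneDsqr x)^-1.
  rewrite ler_pdivlMr ?(lt_le_trans ltr01 (oneDsqr_ge1 x))// /oneDsqr mulrDr mulr1.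
  have h1 : H x ^+ 2 <= (A + B) ^+ 2.
    by rewrite -[H x ^+ 2]real_normK ?num_real// lerXn2r ?nnegrE// addr_ge0.
  have h2 : H x ^+ 2 * x ^+ 2 <= A ^+ 2.
    rewrite -[H x ^+ 2]real_normK ?num_real// -[x ^+ 2]real_normK ?num_real//.
    by rewrite -exprMn mulrC lerXn2r ?nnegrE// mulr_ge0.
  by rewrite /D; have := sqr_ge0 (A - B); nra.
have eH : (energy H <= (pi * D)%:E)%E.
  apply: (@le_trans _ _ (\int[mu]_x (D%:E * ((oneDsqr x)^-1)%:E)))%E.
    apply: ge0_le_integral => //.
    - by move=> x _; rewrite lee_fin sqr_ge0.
    - exact: measurable_sqr.
    - apply: measurable_funeM; apply/measurable_EFinP.
      by apply: continuous_measurable_fun; exact: continuous_oneDsqrV.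
    - by move=> x _; rewrite -EFinM lee_fin HD.
  rewrite ge0_integralZl//.
  - by rewrite integral_oneDsqrV -EFinM mulrC.
  - apply/measurable_EFinP; apply: continuous_measurable_fun.
    exact: continuous_oneDsqrV.
exists H; split => //; split => //; exact: le_lt_trans eH (ltry _).
Qed.

End moment.

(** * Complex-valued functions and their weak derivatives *)

Section complex_functions.
Context {R : realType}.
Implicit Types (f g u v w : R -> R[i]) (r mu z : R[i]) (phi : R -> R).
Local Notation leb := (@lebesgue_measure R).
Local Notation Re := (@complex.Re R).
Local Notation Im := (@complex.Im R).

(** Unlike the modulus, it is polynomial in the real and imaginary parts. *)
Definition normsq z : R := Re z ^+ 2 + Im z ^+ 2.

Lemma normsq_ge0 z : 0 <= normsq z.
Proof. by rewrite addr_ge0 ?sqr_ge0. Qed.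

Lemma normsqM z z' : normsq (z * z') = normsq z * normsq z'.
Proof. by case: z => a b; case: z' => c d; rewrite /normsq/=; ring. Qed.

Lemma normsqD z z' : normsq (z + z') <= 2 * normsq z + 2 * normsq z'.
Proof.
case: z => a b; case: z' => c d; rewrite /normsq/=.
by have := sqr_ge0 (a - c); have := sqr_ge0 (b - d); nra.
Qed.

Lemma normc_sqr z : Normc.normc z ^+ 2 = normsq z.
Proof. by case: z => a b; rewrite /normsq /= sqr_sqrtr// addr_ge0 ?sqr_ge0. Qed.

Lemma Re_mul z z' : Re (z * z') = Re z * Re z' - Im z * Im z'.
Proof. by case: z => a b; case: z'. Qed.

Lemma Im_mul z z' : Im (z * z') = Re z * Im z' + Im z * Re z'.
Proof. by case: z => a b; case: z'. Qed.

Lemma Re_add z z' : Re (z + z') = Re z + Re z'.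
Proof. by case: z => a b; case: z'. Qed.

Lemma Im_add z z' : Im (z + z') = Im z + Im z'.
Proof. by case: z => a b; case: z'. Qed.

Lemma complex_ext z z' : Re z = Re z' -> Im z = Im z' -> z = z'.
Proof. by case: z => a b; case: z' => c d /= -> ->. Qed.

(** The square of the L^2 norm of a complex-valued function; see [cLnorm_sqr]. *)
Definition cenergy u : \bar R := (\int[leb]_x (normsq (u x))%:E)%E.

Lemma cenergy_ge0 u : (0 <= cenergy u)%E.
Proof. by apply: integral_ge0 => x _; rewrite lee_fin normsq_ge0. Qed.

Lemma cmeasurable_normsq u : cmeasurable u -> measurable_fun setT (fun x => normsq (u x)).
Proof. by move=> [mr mi]; apply: measurable_funD; exact: measurable_funX. Qed.

Lemma cmeasurable_normsqE u : cmeasurable u -> measurable_fun setT (fun x => (normsq (u x))%:E).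
Proof. by move=> mu; apply/measurable_EFinP; exact: cmeasurable_normsq. Qed.

Lemma cenergyE u : cmeasurable u ->
  cenergy u = (energy (Re \o u) + energy (Im \o u))%E.
Proof.
move=> [mr mi]; rewrite /cenergy /energy -ge0_integralD//.
- by move=> x _; rewrite lee_fin sqr_ge0.
- exact: measurable_sqr.
- by move=> x _; rewrite lee_fin sqr_ge0.
- exact: measurable_sqr.
Qed.

Lemma ae_cenergy u v : cmeasurable u -> cmeasurable v -> ae_equal u v ->
  cenergy u = cenergy v.
Proof.
move=> mu mv uv; apply: ae_eq_integral => //.
- exact: cmeasurable_normsqE.
- exact: cmeasurable_normsqE.
- by apply: ae_imply uv => x -> _.
Qed.

Definition cL2 u : Prop := cmeasurable u /\ (cenergy u < +oo)%E.

Lemma cL2P u : cL2 u <-> L2 (Re \o u) /\ L2 (Im \o u).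
Proof.
split=> [[mu]|[[mr er] [mi ei]]].
  have [mr mi] := mu; rewrite cenergyE// => h; split; split => //.
    by apply: le_lt_trans h; rewrite leeDl// energy_ge0.
  by apply: le_lt_trans h; rewrite leeDr// energy_ge0.
split; first by [].
by rewrite cenergyE//; exact: lte_add_pinfty.
Qed.

Lemma cLnormE u : cLnorm 2%:E u = sqrte (cenergy u).
Proof.
rewrite /cLnorm unlock poweR12_sqrt; last first.
  by apply: integral_ge0 => x _; exact: poweR_ge0.
congr sqrte; apply: eq_integral => x _.
have nu0 : 0 <= Normc.normc (u x) by case: (u x) => a b; exact: sqrtr_ge0.
by rewrite gee0_abs ?lee_fin// poweR_EFin powR_mulrn// normc_sqr.
Qed.

Lemma cLnorm_sqr u : (cLnorm 2%:E u ^+ 2 = cenergy u)%E.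
Proof. by rewrite cLnormE sqr_sqrte// cenergy_ge0. Qed.

Lemma in_L2P u : in_Lp 2%:E u <-> cL2 u.
Proof.
split=> -[mu h]; split => //.
  rewrite -cLnorm_sqr; move: h; rewrite expe2 => h.
  by apply: lte_mul_pinfty => //; [exact: Lnorm_ge0|rewrite ge0_fin_numE// Lnorm_ge0].
move: h; rewrite -cLnorm_sqr expe2; apply: contraTT.
by rewrite -!leNgt !leye_eq => /eqP ->; rewrite mulyy.
Qed.

Lemma cmeasurableD u v : cmeasurable u -> cmeasurable v -> cmeasurable (u \+ v).
Proof.
move=> [ur ui] [vr vi]; split.
- rewrite (_ : _ \o _ = (Re \o u) \+ (Re \o v)); first exact: measurable_funD.
  by apply/funext => x; exact: Re_add.
- rewrite (_ : _ \o _ = (Im \o u) \+ (Im \o v)); first exact: measurable_funD.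
  by apply/funext => x; exact: Im_add.
Qed.

Lemma cmeasurableZ r u : cmeasurable u -> cmeasurable (fun x => r * u x).
Proof.
move=> [ur ui]; split.
- rewrite (_ : _ \o _ = (fun x => Re r * (Re \o u) x) \- (fun x => Im r * (Im \o u) x)).
    by apply: measurable_funB; exact: measurable_funM.
  by apply/funext => x; exact: Re_mul.
- rewrite (_ : _ \o _ = (fun x => Re r * (Im \o u) x) \+ (fun x => Im r * (Re \o u) x)).
    by apply: measurable_funD; exact: measurable_funM.
  by apply/funext => x; exact: Im_mul.
Qed.

Lemma cenergyZ r u : cmeasurable u ->
  cenergy (fun x => r * u x) = ((normsq r)%:E * cenergy u)%E.
Proof.
move=> mu; rewrite /cenergy -ge0_integralZl//.
- by apply: eq_integral => x _; rewrite normsqM.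
- exact: cmeasurable_normsqE.
- by move=> x _; rewrite lee_fin normsq_ge0.
- by rewrite lee_fin normsq_ge0.
Qed.

Lemma cenergyD u v : cmeasurable u -> cmeasurable v ->
  (cenergy (u \+ v)%R <= 2%:E * cenergy u + 2%:E * cenergy v)%E.
Proof.
move=> mu mv; have mue := cmeasurable_normsqE mu; have mve := cmeasurable_normsqE mv.
rewrite /cenergy -!ge0_integralZl//; last 2 first.
- by move=> x _; rewrite lee_fin normsq_ge0.
- by move=> x _; rewrite lee_fin normsq_ge0.
rewrite -ge0_integralD//.
- apply: ge0_le_integral => //.
  + by move=> x _; rewrite lee_fin normsq_ge0.
  + by apply: cmeasurable_normsqE; exact: cmeasurableD.
  + by apply: emeasurable_funD; exact: measurable_funeM.
  + by move=> x _; rewrite -!EFinM -EFinD lee_fin normsqD.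
- by move=> x _; rewrite -EFinM lee_fin mulr_ge0// normsq_ge0.
- exact: measurable_funeM.
- by move=> x _; rewrite -EFinM lee_fin mulr_ge0// normsq_ge0.
- exact: measurable_funeM.
Qed.

Lemma cL2D u v : cL2 u -> cL2 v -> cL2 (u \+ v).
Proof.
move=> [mu eu] [mv ev]; split; first exact: cmeasurableD.
apply: le_lt_trans (cenergyD mu mv) _.
by apply: lte_add_pinfty; apply: lte_mul_pinfty.
Qed.

Lemma cL2Z r u : cL2 u -> cL2 (fun x => r * u x).
Proof.
move=> [mu eu]; split; first exact: cmeasurableZ.
by rewrite cenergyZ//; apply: lte_mul_pinfty; rewrite ?lee_fin ?normsq_ge0.
Qed.

(** Test functions are real-valued, so both sides of the defining identity split
    into real and imaginary parts. *)
Lemma is_weak_derivativeP k u v : is_weak_derivative k u v <->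
  rweak k (Re \o u) (Re \o v) /\ rweak k (Im \o u) (Im \o v).
Proof.
(* pairing with a real function acts on each part *)
have cint f phi : cintegral (fun x => f x * real_complex R (phi x)) =
    Complex (\int[leb]_x (Re (f x) * phi x)) (\int[leb]_x (Im (f x) * phi x)).
  rewrite /cintegral; congr Complex; apply: eq_Rintegral => x _.
  - by rewrite Re_mul/= mulr0 subr0.
  - by rewrite Im_mul/= mulr0 add0r.
have sgn (a b : R) : (-1) ^+ k * Complex a b = Complex ((-1) ^+ k * a) ((-1) ^+ k * b).
  have [E E'] : (-1) ^+ k = (-1) ^+ odd k :> R[i] /\ (-1) ^+ k = (-1) ^+ odd k :> R.
    by rewrite !signr_odd.
  rewrite E E'; case: (odd k) => /=; last by rewrite !expr0 !mul1r.
  by rewrite !expr1 !mulN1r.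
split=> [[[ur ui] [vr vi] uv]|[[ur vr uvr] [ui vi uvi]]].
  by split; split => // phi /uv; rewrite !cint sgn => -[].
split; [by split|by split|move=> phi tphi].
by rewrite !cint sgn -uvr// -uvi.
Qed.

Lemma cweakD k u v u' v' : is_weak_derivative k u v -> is_weak_derivative k u' v' ->
  is_weak_derivative k (u \+ u') (v \+ v').
Proof.
move=> /is_weak_derivativeP[r i] /is_weak_derivativeP[r' i'].
apply/is_weak_derivativeP; split.
- have := rweakD r r'; congr rweak; apply/funext => x; symmetry; exact: Re_add.
- have := rweakD i i'; congr rweak; apply/funext => x; symmetry; exact: Im_add.
Qed.

Lemma cweakZ k r u v : is_weak_derivative k u v ->
  is_weak_derivative k (fun x => r * u x) (fun x => r * v x).
Proof.
move=> /is_weak_derivativeP[ur ui]; apply/is_weak_derivativeP; split.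
- have := rweakD (rweakZ (Re r) ur) (rweakZ (- Im r) ui).
  by congr rweak; apply/funext => x; rewrite /= Re_mul mulNr.
- have := rweakD (rweakZ (Re r) ui) (rweakZ (Im r) ur).
  by congr rweak; apply/funext => x; rewrite /= Im_mul.
Qed.

Lemma ae_equal_Re u v : ae_equal u v -> {ae leb, forall x, (Re \o u) x = (Re \o v) x}.
Proof. by apply: ae_imply => x /= ->. Qed.

Lemma ae_equal_Im u v : ae_equal u v -> {ae leb, forall x, (Im \o u) x = (Im \o v) x}.
Proof. by apply: ae_imply => x /= ->. Qed.

Lemma ae_equal_trans u v w : ae_equal u v -> ae_equal v w -> ae_equal u w.
Proof. by apply: ae_imply2 => x -> ->. Qed.

Lemma ae_cweak k u v u' v' : cmeasurable u' -> cmeasurable v' ->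
  ae_equal u u' -> ae_equal v v' -> is_weak_derivative k u v -> is_weak_derivative k u' v'.
Proof.
move=> [mur mui] [mvr mvi] uu' vv' /is_weak_derivativeP[r i].
apply/is_weak_derivativeP; split.
- exact: ae_eq_rweak (ae_equal_Re uu') (ae_equal_Re vv') r.
- exact: ae_eq_rweak (ae_equal_Im uu') (ae_equal_Im vv') i.
Qed.

Lemma cweak_unique k u v w : is_weak_derivative k u v -> is_weak_derivative k u w ->
  ae_equal v w.
Proof.
move=> /is_weak_derivativeP[r i] /is_weak_derivativeP[r' i'].
apply: ae_imply2 (rweak_unique r r') (rweak_unique i i') => x /= hr hi.
exact: complex_ext.
Qed.

Lemma cweak_trans k u v w : is_weak_derivative k u v -> is_weak_derivative 1 v w ->
  is_weak_derivative k.+1 u w.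
Proof.
move=> /is_weak_derivativeP[r i] /is_weak_derivativeP[r' i'].
by apply/is_weak_derivativeP; split; [exact: rweak_trans r r'|exact: rweak_trans i i'].
Qed.

Lemma cweak_next k u v w : is_weak_derivative k u v -> is_weak_derivative k.+1 u w ->
  is_weak_derivative 1 v w.
Proof.
move=> /is_weak_derivativeP[r i] /is_weak_derivativeP[r' i'].
by apply/is_weak_derivativeP; split; [exact: rweak_next r r'|exact: rweak_next i i'].
Qed.

Lemma cweak_measurable k u v : is_weak_derivative k u v -> cmeasurable u /\ cmeasurable v.
Proof. by move=> [[[? _ _] [? _ _]] [[? _ _] [? _ _]] _]. Qed.

End complex_functions.

(** * First-order equations with a complex coefficient *)

Section first_order.
Context {R : realType}.
Implicit Types (f g u v w : R -> R[i]) (r mu z : R[i]) (phi : R -> R).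
Local Notation leb := (@lebesgue_measure R).
Local Notation Re := (@complex.Re R).
Local Notation Im := (@complex.Im R).

(** The function exp (mu x), through its real and imaginary parts. *)
Definition cexp mu (x : R) : R[i] :=
  Complex (expR (Re mu * x) * cos (Im mu * x)) (expR (Re mu * x) * sin (Im mu * x)).

Lemma cexpNK mu (x : R) : cexp mu x * cexp (- mu) x = 1.
Proof.
case: mu => a b; apply: complex_ext; rewrite ?Re_mul ?Im_mul /= !mulNr cosN sinN.
- rewrite (_ : _ - _ = (expR (a * x) * expR (- (a * x))) *
    (cos (b * x) ^+ 2 + sin (b * x) ^+ 2)); last by ring.
  by rewrite -expRD subrr expR0 mul1r cos2Dsin2.
- by ring.
Qed.

Lemma normsq_cexp mu (x : R) : normsq (cexp mu x) = expR (2 * Re mu * x).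
Proof.
rewrite /normsq/= !exprMn -mulrDr cos2Dsin2 mulr1 expr2 -expRD.
by congr expR; ring.
Qed.

Lemma smooth_cosZ (c : R) : smooth (fun x : R => cos (c * x)).
Proof.
have := @smooth_affine R _ c 0 (@smooth_cos R); congr smooth.
by apply/funext => x; rewrite addr0.
Qed.

Lemma smooth_sinZ (c : R) : smooth (fun x : R => sin (c * x)).
Proof.
have := @smooth_affine R _ c 0 (@smooth_sin R); congr smooth.
by apply/funext => x; rewrite addr0.
Qed.

Lemma smooth_cexp mu : smooth (Re \o cexp mu) /\ smooth (Im \o cexp mu).
Proof.
split.
- exact: (smoothM (@smooth_expRZ R (Re mu)) (@smooth_cosZ (Im mu))).
- exact: (smoothM (@smooth_expRZ R (Re mu)) (@smooth_sinZ (Im mu))).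
Qed.

Lemma derive1_cexp mu :
  derive1 (Re \o cexp mu) = (fun x => Re (mu * cexp mu x)) /\
  derive1 (Im \o cexp mu) = (fun x => Im (mu * cexp mu x)).
Proof.
case: mu => a b.
have de (x : R) : is_derive x 1 (fun y : R => expR (a * y)) (a * expR (a * x)).
  by rewrite -[X in is_derive _ _ _ X]/((fun x => a * expR (a * x)) x) -derive1_expRZ;
  apply: smooth_is_derive; exact: smooth_expRZ.
have dl (x : R) : is_derive x 1 (fun y : R => b * y) b.
  by apply: is_derive_eq; rewrite /GRing.scale/= mulr1.
have dc (x : R) : is_derive x 1 (fun y : R => cos (b * y)) (- sin (b * x) * b).
  exact: (is_derive1_comp (f := cos) (g := fun y => b * y)).
have ds (x : R) : is_derive x 1 (fun y : R => sin (b * y)) (cos (b * x) * b).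
  exact: (is_derive1_comp (f := sin) (g := fun y => b * y)).
split; apply/funext => x; rewrite derive1E.
- rewrite (@derive_val _ _ _ _ _ _ _ (is_deriveM (de x) (dc x))).
  by rewrite Re_mul/= /GRing.scale/=; ring.
- rewrite (@derive_val _ _ _ _ _ _ _ (is_deriveM (de x) (ds x))).
  by rewrite Im_mul/= /GRing.scale/=; ring.
Qed.

(** The product rule with the factor exp (mu x), whose real and imaginary parts
    are smooth.  This is the integrating factor for first-order equations. *)
Lemma cweak_cexp mu u v : is_weak_derivative 1 u v ->
  is_weak_derivative 1 (fun x => cexp mu x * u x)
                       (fun x => cexp mu x * (mu * u x + v x)).
Proof.
move=> /is_weak_derivativeP[ur ui].
have [sr si] := smooth_cexp mu; have [dr di] := derive1_cexp mu.
have rr := rweakM sr ur; have ri := rweakM sr ui.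
have ir := rweakM si ur; have ii := rweakM si ui.
apply/is_weak_derivativeP; split.
- have := rweakD rr (rweakZ (-1) ii); congr rweak; apply/funext => x; rewrite /= ?dr ?di.
  + by rewrite Re_mul /=; ring.
  + by rewrite !(Re_mul, Im_mul, Re_add, Im_add) /=; ring.
- have := rweakD ri ir; congr rweak; apply/funext => x; rewrite /= ?dr ?di.
  + by rewrite Im_mul /=; ring.
  + by rewrite !(Re_mul, Im_mul, Re_add, Im_add) /=; ring.
Qed.

Lemma cmeasurable_cexp mu u : cmeasurable u -> cmeasurable (fun x => cexp mu x * u x).
Proof.
have [sr si] := smooth_cexp mu; have mr := smooth_measurable sr; have mi := smooth_measurable si.
move=> [ur ui]; split.
- rewrite (_ : _ \o _ = (Re \o cexp mu) \* (Re \o u) \- (Im \o cexp mu) \* (Im \o u)).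
    by apply: measurable_funB; exact: measurable_funM.
  by apply/funext => x; exact: Re_mul.
- rewrite (_ : _ \o _ = (Re \o cexp mu) \* (Im \o u) \+ (Im \o cexp mu) \* (Re \o u)).
    by apply: measurable_funD; exact: measurable_funM.
  by apply/funext => x; exact: Im_mul.
Qed.

(** The modulus of exp (i b x) is 1. *)
Lemma cenergy_modulation (b : R) u : cenergy (fun x => cexp (Complex 0 b) x * u x) = cenergy u.
Proof.
by apply: eq_integral => x _; rewrite normsqM normsq_cexp/= mulr0 mul0r expR0 mul1r.
Qed.

(** With r = a + i b, the substitution u = exp (i b x) v turns the equation into
    v' = a v + exp (- i b x) g.  Its coefficient is real, so it can be solved for
    the real and the imaginary parts separately, and neither substitution
    changes L^2 norms. *)
Lemma solve_complex r g : Re r != 0 -> cL2 g -> exists u, [/\ cL2 u,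
  is_weak_derivative 1 u (fun x => r * u x + g x) &
  (cenergy u <= ((Re r)^-1 ^+ 2)%:E * cenergy g)%E].
Proof.
case: r => a b /= a0 [mg eg].
pose h x := cexp (- Complex 0 b) x * g x.
have eh : cenergy h = cenergy g.
  rewrite /h (_ : - Complex 0 b = Complex 0 (- b)); first exact: cenergy_modulation.
  by apply: complex_ext; rewrite /= ?oppr0.
have mh : cmeasurable h by exact: cmeasurable_cexp.
have Lh : cL2 h by split => //; rewrite eh.
have [Lhr Lhi] := (cL2P h).1 Lh.
have [vr [Lvr wvr evr]] := solve_real a0 Lhr.
have [vi [Lvi wvi evi]] := solve_real a0 Lhi.
pose v x := Complex (vr x) (vi x).
have Lv : cL2 v by apply/cL2P.
have wv : is_weak_derivative 1 v (fun x => Complex a 0 * v x + h x).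
  apply/is_weak_derivativeP; split.
  - move: wvr; congr rweak; apply/funext => x.
    by rewrite /= Re_add Re_mul/= mul0r subr0.
  - move: wvi; congr rweak; apply/funext => x.
    by rewrite /= Im_add Im_mul/= mul0r addr0.
pose u x := cexp (Complex 0 b) x * v x.
have mu : cmeasurable u by apply: cmeasurable_cexp; case: Lv.
have eu : (cenergy u <= (a^-1 ^+ 2)%:E * cenergy g)%E.
  rewrite cenergy_modulation -eh !cenergyE//; last by case: Lv.
  rewrite ge0_muleDr ?energy_ge0//; exact: leeD.
exists u; split => //.
- split => //; apply: le_lt_trans eu _.
  by apply: lte_mul_pinfty; rewrite ?lee_fin ?sqr_ge0 ?cenergy_ge0.
- have := cweak_cexp (Complex 0 b) wv; congr (is_weak_derivative 1 _); apply/funext => x.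
  rewrite /u /h addrA -mulrDl (_ : Complex 0 b + Complex a 0 = Complex a b); last first.
    by apply: complex_ext; rewrite /= ?add0r ?addr0.
  by rewrite mulrDr mulrA (mulrA (cexp _ x) (cexp _ x)) cexpNK mul1r; ring.
Qed.

(** exp (- r x) u has weak derivative zero, hence is a constant almost
    everywhere; so |u|^2 = D exp (2 Re r x) for a constant D.  On one of the two
    half-lines the exponential is at least 1, so D > 0 would contradict
    integrability. *)
Lemma solution_zero r u : cL2 u -> is_weak_derivative 1 u (fun x => r * u x) ->
  ae_equal u (fun=> 0).
Proof.
move=> [mu eu] wu.
have := cweak_cexp (- r) wu.
rewrite (_ : (fun x => cexp (- r) x * (- r * u x + r * u x)) = fun=> 0); last first.
  by apply/funext => x; rewrite -mulrDl addNr mul0r mulr0.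
move=> /is_weak_derivativeP[/rweak0_const[c cP] /rweak0_const[d dP]].
pose D := normsq (Complex c d).
have uD : {ae leb, forall x, normsq (u x) = expR (2 * Re r * x) * D}.
  apply: ae_imply2 cP dP => x /= hc hd.
  rewrite -[u x]mul1r -(cexpNK r x) -mulrA normsqM normsq_cexp; congr (_ * normsq _).
  exact: complex_ext.
have D0 : D = 0.
  apply/eqP/negPn/negP => Dn0.
  have {Dn0}Dgt0 : 0 < D by rewrite lt_neqAle eq_sym Dn0 normsq_ge0.
  (* a half-line A on which exp (2 Re r x) >= 1 has infinite measure *)
  have half (A : set (measurableTypeR R)) : measurable A -> leb A = +oo%E ->
      (forall x, A x -> 0 <= Re r * x) -> False.
    move=> mA Aoo rA; move: eu; apply/negP.
    rewrite -leNgt -[leLHS](_ : D%:E * leb A = _)%E; last first.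
      by rewrite Aoo gt0_muley// lte_fin.
    rewrite -integral_cst//.
    apply: (@le_trans _ _ (\int[leb]_(x in A) (normsq (u x))%:E)%E); last first.
      apply: ge0_subset_integral => //; first exact: cmeasurable_normsqE.
      by move=> x _; rewrite lee_fin normsq_ge0.
    apply: ae_ge0_le_integral => //.
    - by move=> x _; rewrite lee_fin ltW.
    - by move=> x _; rewrite lee_fin normsq_ge0.
    - by apply: measurable_funTS; exact: cmeasurable_normsqE.
    - apply: ae_imply uD => x -> Ax; rewrite lee_fin ler_peMl ?(ltW Dgt0)//.
      by rewrite -expR0 ler_expR -mulrA mulr_ge0// rA.
  have [r0|r0] := leP 0 (Re r).
    apply: (half `[0, +oo[%classic) => //; first by rewrite lebesgue_measure_itv/= ltry addye.
    by move=> x; rewrite /= in_itv/= andbT => x0; rewrite mulr_ge0.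
  apply: (half `]-oo, 0]%classic) => //; first by rewrite lebesgue_measure_itv/= ltNyr.
  by move=> x; rewrite /= in_itv/= => x0; rewrite mulr_le0// ltW.
apply: ae_imply uD => x; rewrite D0 mulr0 => /eqP.
rewrite /normsq paddr_eq0 ?sqr_ge0// !sqrf_eq0 => /andP[/eqP ur /eqP ui].
exact: complex_ext.
Qed.

End first_order.

(** * Products of first-order operators *)

Section factored_operators.
Context {R : realType}.
Implicit Types (f g u v : R -> R[i]) (w : nat -> R -> R[i]) (r : R[i]) (rs : seq R[i]).
Local Notation leb := (@lebesgue_measure R).
Local Notation Re := (@complex.Re R).
Local Notation Im := (@complex.Im R).

(** A function w 0 with its weak derivatives w 1, ..., w n, all in L^2.  As weak
    derivatives are defined up to null sets only, choosing representatives once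
    lets operators act on the sequence w pointwise. *)
Definition weak_chain n w : Prop :=
  (forall i, (i <= n)%N -> cL2 (w i)) /\
  (forall i, (i < n)%N -> is_weak_derivative 1 (w i) (w i.+1)).

Definition shift_sub r w : nat -> R -> R[i] := fun i x => w i.+1 x - r * w i x.

(** The operator (D - r1) ... (D - rn) for rs = r1 :: ... :: rn.  If w consists of
    the derivatives of u, then [shift_sub r w] consists of those of
    (D - r) u. *)
Fixpoint factored rs w : R -> R[i] :=
  if rs is r :: rs' then factored rs' (shift_sub r w) else w 0%N.

Lemma cL2B r u v : cL2 u -> cL2 v -> cL2 (fun x => u x - r * v x).
Proof.
move=> Lu Lv; have := cL2D Lu (cL2Z (- r) Lv); congr cL2.
by apply/funext => x; rewrite /= mulNr.
Qed.

Lemma cweakB k r u v u' v' : is_weak_derivative k u v -> is_weak_derivative k u' v' ->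
  is_weak_derivative k (fun x => u x - r * u' x) (fun x => v x - r * v' x).
Proof.
move=> uv uv'; have := cweakD uv (cweakZ (- r) uv'); congr (is_weak_derivative k _ _);
  by apply/funext => x; rewrite /= mulNr.
Qed.

Lemma weak_chain_shift n r w : weak_chain n.+1 w -> weak_chain n (shift_sub r w).
Proof.
move=> [Lw Dw]; split=> i ni.
- by apply: cL2B; apply: Lw => //; exact: leqW.
- by apply: cweakB; apply: Dw => //; exact: leqW.
Qed.

Lemma weak_chain_sub n w w' : weak_chain n w -> weak_chain n w' ->
  weak_chain n (fun i x => w i x - w' i x).
Proof.
move=> [Lw Dw] [Lw' Dw']; split=> i ni.
- have := cL2B 1 (Lw _ ni) (Lw' _ ni); congr cL2.
  by apply/funext => x; rewrite mul1r.
- have := cweakB 1 (Dw _ ni) (Dw' _ ni); congr (is_weak_derivative 1 _ _);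
    by apply/funext => x; rewrite mul1r.
Qed.

Lemma factored_sub rs w w' x :
  factored rs (fun i x => w i x - w' i x) x = factored rs w x - factored rs w' x.
Proof.
elim: rs w w' => [//|r rs IH] w w' /=; rewrite -IH; congr (factored rs _ x).
by apply/funext => i; apply/funext => y; rewrite /shift_sub; ring.
Qed.

(** Uniqueness for (D - r1) ... (D - rn) u = 0: by induction (D - r1) u = 0, and
    [solution_zero] concludes. *)
Lemma weak_chain_zero rs w : weak_chain (size rs) w ->
  ae_equal (factored rs w) (fun=> 0) -> ae_equal (w 0%N) (fun=> 0).
Proof.
elim: rs w => [//|r rs IH] w /= cw /(IH _ (weak_chain_shift r cw)) w10.
have [Lw Dw] := cw; have w01 := Dw 0%N isT.
apply: (@solution_zero R r); first exact: Lw.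
apply: (ae_cweak _ _ _ _ w01).
- by case: (Lw 0%N isT).
- by apply: cmeasurableZ; case: (Lw 0%N isT).
- by apply: aeW.
- by apply: ae_imply w10 => x /eqP; rewrite subr_eq0 => /eqP.
Qed.

(** Existence with an a priori bound: every right-hand side f in F has a solution
    whose derivatives are bounded by the quantity B f, up to constants that do
    not depend on f. *)
Definition solvable rs (F : set (R -> R[i])) (B : (R -> R[i]) -> \bar R) : Prop :=
  exists2 C : nat -> R, (forall i, 0 <= C i) & forall f, F f ->
    exists w, [/\ weak_chain (size rs) w, factored rs w = f &
      forall i, (i <= size rs)%N -> (cenergy (w i) <= (C i)%:E * B f)%E].

(** Let w be the chain of a solution for rs.  Solve (D - r) u = w 0; the
    derivatives of u are then given by the recursion
    w' (i + 1) = r w' i + w i, so they are in L^2 with the expected bounds. *)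
Lemma solvable_cons r rs F B : Re r != 0 -> solvable rs F B -> solvable (r :: rs) F B.
Proof.
move=> r0 [C C0 CP]; have nr := normsq_ge0 r.
(* the constants follow the recursion for w', using
   |z + z'|^2 <= 2 |z|^2 + 2 |z'|^2 *)
pose C' := fix C' (i : nat) : R :=
  if i is j.+1 then 2 * (normsq r * C' j) + 2 * C j else (Re r)^-1 ^+ 2 * C 0%N.
have C'0 i : 0 <= C' i.
  by elim: i => [|i IH] /=; [rewrite mulr_ge0// sqr_ge0|rewrite addr_ge0// !mulr_ge0].
exists C' => // f /CP[w [[Lw Dw] wf ew]].
have [u [Lu Du eu]] := solve_complex r0 (Lw 0%N isT).
pose w' := fix w' (i : nat) : R -> R[i] :=
  if i is j.+1 then fun x => r * w' j x + w j x else u.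
have Lw' i : (i <= (size rs).+1)%N -> cL2 (w' i).
  elim: i => [//|i IH] ni /=; apply: cL2D; last exact: Lw.
  by apply: cL2Z; apply: IH; exact: ltnW.
have ew' i : (i <= (size rs).+1)%N -> (cenergy (w' i) <= (C' i)%:E * B f)%E.
  elim: i => [_|i IH ni].
    apply: (le_trans eu).
    rewrite [leRHS](_ : _ = ((Re r)^-1 ^+ 2)%:E * ((C 0%N)%:E * B f))%E; last first.
      by rewrite muleA -EFinM.
    rewrite lee_wpmul2l ?lee_fin ?sqr_ge0//.
    exact: ew.
  have [mw _] := Lw _ ni; have [mw' _] := Lw' _ (ltnW ni).
  apply: (le_trans (cenergyD (cmeasurableZ r mw') mw)); rewrite cenergyZ//=.
  have -> : ((2 * (normsq r * C' i) + 2 * C i)%:E * B f =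
      2%:E * ((normsq r)%:E * ((C' i)%:E * B f)) + 2%:E * ((C i)%:E * B f))%E.
    by rewrite EFinD ge0_muleDl ?lee_fin ?mulr_ge0// !muleA -!EFinM mulrA.
  apply: leeD; rewrite lee_wpmul2l//; last exact: ew.
  by rewrite lee_wpmul2l ?lee_fin//; apply: IH; exact: ltnW.
exists w'; split => //.
- split => // i; elim: i => [_|i IH ni]; first exact: Du.
  apply: cweakD; last exact: Dw.
  by apply: cweakZ; apply: IH; exact: ltnW.
- rewrite /= -wf; congr factored; apply/funext => i; apply/funext => x.
  by rewrite /shift_sub /= addrC addKr.
Qed.

Lemma solvable_all rs rs' F B : all (fun r => Re r != 0) rs ->
  solvable rs' F B -> solvable (rs ++ rs') F B.
Proof.
by elim: rs => [//|r rs IH] /= /andP[r0 rs0] H; apply: solvable_cons => //; exact: IH.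
Qed.

Lemma solvable_nil : solvable [::] cL2 cenergy.
Proof.
exists (fun=> 1) => // f Lf; exists (fun=> f); split => //.
by move=> i _; rewrite mul1e.
Qed.

Definition cmoment f (x : R) : R[i] := real_complex R x * f x.

(** Right-hand sides for which [solve_zero] applies to both parts. *)
Definition balanced f : Prop := [/\ cL2 f,
  leb.-integrable setT (EFin \o moment (Re \o f)),
  leb.-integrable setT (EFin \o moment (Im \o f)),
  \int[leb]_x Re (f x) = 0 & \int[leb]_x Im (f x) = 0].

(** Both moments enter squared, which makes this a quadratic quantity like
    [cenergy]. *)
Definition weighted_energy f : \bar R := (cenergy f +
  ((\int[leb]_x `|moment (Re \o f) x|) ^+ 2 +
   (\int[leb]_x `|moment (Im \o f) x|) ^+ 2)%:E)%E.

Lemma solvable_zero : solvable [:: 0] balanced weighted_energy.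
Proof.
exists (fun i => if i is 0 then 4 * pi else 1).
  by case => [|//]; rewrite mulr_ge0// pi_ge0.
move=> f [Lf mr mi fr fi]; have [Lr Li] := (cL2P f).1 Lf.
have [vr [Lvr wvr evr]] := solve_zero Lr mr fr.
have [vi [Lvi wvi evi]] := solve_zero Li mi fi.
pose v x := Complex (vr x) (vi x).
have Lv : cL2 v by apply/cL2P.
exists (fun i => if i is 0 then v else f); split.
- split=> [[|i] _ //|[|i] // _].
  by apply/is_weak_derivativeP.
- by apply/funext => x; rewrite /= /shift_sub/= mul0r subr0.
- case=> [_|i _]; last by rewrite mul1e leeDl// lee_fin addr_ge0// sqr_ge0.
  rewrite cenergyE; last by case: Lv.
  have efin (g : R -> R) : L2 g -> energy g \is a fin_num.
    by move=> [_ ?]; rewrite ge0_fin_numE// energy_ge0.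
  move: evr evi; set E := fine _ => evr; set E' := fine _ => evi.
  have cE : cenergy f = (E + E')%:E.
    by rewrite cenergyE; [rewrite EFinD !fineK ?efin|case: Lf].
  apply: (le_trans (leeD evr evi)).
  rewrite /weighted_energy cE -!EFinD -EFinM lee_fin.
  set A := \int[leb]_x _; set A' := \int[leb]_x _.
  have := pi_ge0 R; have := sqr_ge0 A; have := sqr_ge0 A'.
  move=> h1 h2 h3; rewrite -subr_ge0.
  rewrite (_ : _ - _ = pi * (A ^+ 2 + A' ^+ 2)); last by ring.
  by rewrite mulr_ge0// addr_ge0.
Qed.

Lemma weak_chain_weak n w k : weak_chain n w -> (k < n)%N ->
  is_weak_derivative k.+1 (w 0%N) (w k.+1).
Proof.
move=> [_ Dw]; elim: k => [|k IH] kn; first exact: Dw.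
by apply: cweak_trans (IH (ltnW kn)) _; exact: Dw.
Qed.

Lemma wderivP k u v : is_weak_derivative k u v -> is_weak_derivative k u (wderiv k u).
Proof.
move=> uv.
exact: (@xgetPex _ (fun=> 0) [set v | is_weak_derivative k u v]) (ex_intro _ v uv).
Qed.

Lemma weak_chain_wderiv n w k : weak_chain n w -> (k < n)%N ->
  ae_equal (wderiv k.+1 (w 0%N)) (w k.+1).
Proof.
by move=> cw kn; have h := weak_chain_weak cw kn; exact: cweak_unique (wderivP h) h.
Qed.

Lemma weak_chain_sobolevH n w : weak_chain n w -> sobolevH n (w 0%N).
Proof.
move=> cw; have [Lw _] := cw; split; first exact/in_L2P/Lw.
move=> [//|k] /andP[_ kn]; exists (w k.+1); first exact/in_L2P/Lw.
exact: (weak_chain_weak cw kn).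
Qed.

Lemma sobolevH_weak_chain n u : sobolevH n u ->
  weak_chain n (fun i => if i is 0 then u else wderiv i u).
Proof.
move=> [Lu Du].
have D k : (k < n)%N -> is_weak_derivative k.+1 u (wderiv k.+1 u) /\ cL2 (wderiv k.+1 u).
  move=> kn; have [v Lv uv] := Du k.+1 kn; have uw := wderivP uv; split => //.
  have /in_L2P[mv ev] := Lv; have [_ mw] := cweak_measurable uw.
  by split => //; rewrite (ae_cenergy mw mv (cweak_unique uw uv)).
split=> [[|i] ni|[|i] ni].
- exact/in_L2P.
- by case: (D _ ni).
- by case: (D _ ni).
- by have [h1 _] := D _ (ltnW ni); have [h2 _] := D _ ni; exact: cweak_next h1 h2.
Qed.

End factored_operators.

(** * The characteristic polynomial *)

Section characteristic_polynomial.
Context {R : realType}.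
Implicit Types (w : nat -> R -> R[i]) (p q : {poly R[i]}) (r : R[i]) (rs : seq R[i]).
Local Notation Re := (@complex.Re R).
Local Notation Im := (@complex.Im R).

(** The value of p(D) u at x, when w consists of u and its derivatives. *)
Definition apply_poly p w (x : R) : R[i] := \sum_(i < size p) p`_i * w i x.

Lemma apply_poly_wide n p w x : (size p <= n)%N ->
  apply_poly p w x = \sum_(i < n) p`_i * w i x.
Proof.
move=> pn; rewrite /apply_poly (big_ord_widen n (fun i => p`_i * w i x) pn).
rewrite big_mkcond/=; apply: eq_bigr => i _; case: ltnP => // ip.
by rewrite nth_default// mul0r.
Qed.

Lemma apply_poly_XsubC r q w x :
  apply_poly (('X - r%:P) * q) w x = apply_poly q (shift_sub r w) x.
Proof.
rewrite (@apply_poly_wide (size q).+1); last first.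
  by rewrite (leq_trans (size_polyMleq _ _))// size_XsubC.
under eq_bigr do rewrite mulrBl coefB coefXM coefCM mulrBl.
rewrite sumrB big_ord_recl/= mul0r add0r big_ord_recr/= [q`_(size q)]nth_default//.
rewrite mulr0 mul0r addr0 -sumrB; apply: eq_bigr => i _.
by rewrite /shift_sub mulrBr mulrA [r * _]mulrC.
Qed.

(** Multiplication by 'X - r corresponds to [shift_sub r], so a product of
    operators is the operator of the product polynomial. *)
Lemma factored_apply_poly rs w x :
  factored rs w x = apply_poly (\prod_(r <- rs) ('X - r%:P)) w x.
Proof.
elim: rs w => [|r rs IH] w; last by rewrite big_cons apply_poly_XsubC -IH.
by rewrite big_nil /apply_poly size_poly1 big_ord1 coef1 mul1r.
Qed.

(** The polynomial 'X^4 - 'X^2 - b 'X - a, given by its coefficients so that they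
    can be computed. *)
Definition ode_poly (a b : R[i]) : {poly R[i]} := Poly [:: - a; - b; -1; 0; 1].

Lemma polyseq_ode_poly a b : ode_poly a b = [:: - a; - b; -1; 0; 1] :> seq R[i].
Proof. by apply: (@PolyK _ 0); rewrite /= oner_eq0. Qed.

Lemma factored_ode_poly a b rs w x :
  \prod_(r <- rs) ('X - r%:P) = ode_poly a b ->
  factored rs w x = - w 2%N x + w 4%N x - b * w 1%N x - a * w 0%N x.
Proof.
move=> rsE; rewrite factored_apply_poly rsE.
rewrite (@apply_poly_wide 5) ?polyseq_ode_poly// !big_ord_recl big_ord0/=.
by ring.
Qed.

Lemma lead_coef_ode_poly a b : lead_coef (ode_poly a b) = 1.
Proof. by rewrite lead_coefE polyseq_ode_poly. Qed.

(** The symbol of the operator at the frequency d. *)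
Lemma ode_poly_imaginary (a b d : R) :
  (ode_poly (real_complex R a) (real_complex R b)).[Complex 0 d] =
  Complex (d ^+ 4 + d ^+ 2 - a) (- (b * d)).
Proof.
by apply: complex_ext; rewrite /ode_poly horner_Poly /=; ring.
Qed.

(** The imaginary part of the symbol forces d = 0 because b is nonzero; its
    real part then forces a = 0. *)
Lemma ode_poly_root_imaginary (a b : R) r : 0 <= a -> b != 0 ->
  root (ode_poly (real_complex R a) (real_complex R b)) r ->
  Re r = 0 -> r = 0 /\ a = 0.
Proof.
case: r => c d a0 b0 /rootP + /= c0; rewrite c0 ode_poly_imaginary => -[].
move=> hr /eqP; rewrite oppr_eq0 mulf_eq0 (negbTE b0)/= => /eqP d0.
by move: hr; rewrite d0 !expr0n/= !add0r => /eqP; rewrite oppr_eq0 => /eqP.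
Qed.

Lemma monic_split (p : {poly R[i]}) : lead_coef p = 1 ->
  exists rs, \prod_(r <- rs) ('X - r%:P) = p.
Proof.
move=> p1; have [rs ->] := closed_field_poly_normal p.
by exists rs; rewrite p1 scale1r.
Qed.

Definition characteristic_roots (a b : R) rs : Prop :=
  \prod_(r <- rs) ('X - r%:P) = ode_poly (real_complex R a) (real_complex R b).

Lemma size_characteristic_roots (a b : R) rs :
  characteristic_roots a b rs -> size rs = 4%N.
Proof.
move=> rsE; have := congr1 size (polyseq_ode_poly (real_complex R a) (real_complex R b)).
by rewrite -rsE size_prod_XsubC => -[].
Qed.

Lemma characteristic_roots_gt0 (a b : R) : 0 < a -> b != 0 ->
  exists2 rs, characteristic_roots a b rs & all (fun r => Re r != 0) rs.
Proof.
move=> a0 b0.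
have [rs rsE] := monic_split (lead_coef_ode_poly (real_complex R a) (real_complex R b)).
exists rs => //.
apply/allP => r rrs; apply/eqP => r0.
have [_ /eqP] : r = 0 /\ a = 0.
  by apply: (ode_poly_root_imaginary (ltW a0) b0) => //; rewrite -rsE root_prod_XsubC.
by rewrite gt_eqF.
Qed.

(** For a = 0 the factor 'X splits off, and the remaining cubic
    'X^3 - 'X - b does not vanish at 0.  The root 0 is placed last in the
    list, so that the equation with coefficient 0 is the first to be solved,
    directly on the data. *)
Lemma characteristic_roots_eq0 (b : R) : b != 0 ->
  exists2 rs, characteristic_roots 0 b (rs ++ [:: 0]) & all (fun r => Re r != 0) rs.
Proof.
move=> b0; set c := real_complex R b.
pose q : {poly R[i]} := Poly [:: - c; -1; 0; 1].
have qE : q * 'X = ode_poly 0 c.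
  by rewrite /ode_poly [RHS]cons_poly_def oppr0 polyC0 addr0.
have q1 : lead_coef q = 1.
  by have := lead_coef_ode_poly 0 c; rewrite -qE lead_coefM lead_coefX mulr1.
have [rs rsE] := monic_split q1.
have prodE : \prod_(r <- rs ++ [:: 0]) ('X - r%:P) = ode_poly 0 c.
  by rewrite big_cat big_seq1/= rsE polyC0 subr0.
exists rs => //.
apply/allP => r rrs; apply/eqP => r0.
have qr : root q r by rewrite -rsE root_prod_XsubC.
have [r00 _] : r = 0 /\ (0 : R) = 0.
  by apply: (ode_poly_root_imaginary (lexx 0) b0) => //; rewrite -qE rootM qr.
move: qr; rewrite r00 /root /q horner_Poly/= => /eqP/(congr1 Re)/=.
by rewrite !mulr0 subr0 add0r => /eqP; rewrite oppr_eq0 (negbTE b0).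
Qed.

End characteristic_polynomial.

(** * Well-posedness in H^4 *)

Section convergence.
Context {R : realType}.
Implicit Types (f g u v : R -> R[i]) (w : nat -> R -> R[i]) (rs : seq R[i]).
Local Notation leb := (@lebesgue_measure R).
Local Notation Re := (@complex.Re R).
Local Notation Im := (@complex.Im R).

Lemma cvg0_squeeze (x_ y_ : nat -> \bar R) : (forall n, (0 <= x_ n <= y_ n)%E) ->
  y_ @ \oo --> 0%E -> x_ @ \oo --> 0%E.
Proof.
move=> xy y0; apply: squeeze_cvge y0; last exact: cvg_cst.
by apply: nearW => n; exact: xy.
Qed.

Lemma cvg0_scale (c : R) (x_ : nat -> \bar R) :
  x_ @ \oo --> 0%E -> (fun n => c%:E * x_ n)%E @ \oo --> 0%E.
Proof. by move=> x0; rewrite -(mule0 c%:E); apply: cvgeZl. Qed.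

Lemma cvg0_sqr (x_ : nat -> \bar R) :
  x_ @ \oo --> 0%E -> (fun n => x_ n ^+ 2)%E @ \oo --> 0%E.
Proof.
move=> x0; under eq_fun do rewrite expe2.
by rewrite -(mule0 0%E); apply: cvgeM.
Qed.

Lemma cvg0_sqrte (x_ : nat -> \bar R) : (forall n, (0 <= x_ n)%E) ->
  x_ @ \oo --> 0%E -> (fun n => sqrte (x_ n)) @ \oo --> 0%E.
Proof.
move=> x_ge0 /fine_cvgP[xfin x0]; apply/fine_cvgP; split.
  by apply: filterS xfin => n xn; rewrite sqrte_fin_num.
have : Num.sqrt (fine (x_ n)) @[n --> \oo] --> Num.sqrt (0 : R).
  by apply: continuous_cvg => //; exact: sqrt_continuous.
rewrite sqrtr0; apply: cvg_trans; apply: near_eq_cvg.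
by apply: filterS xfin => n xn /=; rewrite -[in RHS](fineK xn).
Qed.

(** The weak derivatives selected by [wderiv], with u itself at index 0. *)
Definition derivatives u : nat -> R -> R[i] := fun i => if i is 0 then u else wderiv i u.

Lemma solution_chain (a b : R) rs f u : characteristic_roots a b rs ->
  solution a b f u ->
  weak_chain 4 (derivatives u) /\ ae_equal (factored rs (derivatives u)) f.
Proof.
move=> rsE [Hu uf]; split; first exact: sobolevH_weak_chain.
by apply: ae_imply uf => x; rewrite (factored_ode_poly _ _ rsE).
Qed.

Lemma chain_solution (a b : R) rs w f : characteristic_roots a b rs ->
  weak_chain 4 w -> ae_equal (factored rs w) f -> solution a b f (w 0%N).
Proof.
move=> rsE cw wf; split; first exact: weak_chain_sobolevH cw.
have D1 := weak_chain_wderiv cw (k := 0) isT.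
have D2 := weak_chain_wderiv cw (k := 1) isT.
have D4 := weak_chain_wderiv cw (k := 3) isT.
apply: ae_equal_trans wf.
have D12 : {ae leb, forall x, wderiv 1 (w 0%N) x = w 1%N x /\ wderiv 2 (w 0%N) x = w 2%N x}.
  by apply: ae_imply2 D1 D2.
by apply: ae_imply2 D12 D4 => x [-> ->] ->; rewrite (factored_ode_poly _ _ rsE).
Qed.

Lemma chain_unique rs w w' f : weak_chain (size rs) w -> weak_chain (size rs) w' ->
  ae_equal (factored rs w) f -> ae_equal (factored rs w') f ->
  ae_equal (w 0%N) (w' 0%N).
Proof.
move=> cw cw' wf wf'.
have : ae_equal (fun x => w 0%N x - w' 0%N x) (fun=> 0).
  apply: (weak_chain_zero (weak_chain_sub cw cw')).
  by apply: ae_imply2 wf wf' => x; rewrite factored_sub => -> ->; rewrite subrr.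
by apply: ae_imply => x /eqP; rewrite subr_eq0 => /eqP.
Qed.

Lemma H4norm_chain w : weak_chain 4 w ->
  H4norm (w 0%N) = sqrte (cenergy (w 0%N) + cenergy (w 4%N)).
Proof.
move=> cw; rewrite /H4norm !cLnorm_sqr; congr (sqrte (_ + _)%E).
have h := weak_chain_weak cw (k := 3) isT; have h' := wderivP h.
apply: ae_cenergy; last exact: (weak_chain_wderiv cw (k := 3)).
  exact: (cweak_measurable h').2.
exact: (cweak_measurable h).2.
Qed.

(** By uniqueness, u_m - u agrees with the solution that [solvable] provides for
    f_m - f, so it inherits the bound on its derivatives. *)
Lemma well_posed (a b : R) rs (F : set (R -> R[i])) (B : (R -> R[i]) -> \bar R)
    f (f_ : nat -> R -> R[i]) :
  characteristic_roots a b rs -> solvable rs F B -> F f -> (forall m, F (f_ m)) ->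
  (forall m, F (fun x => f_ m x - f x)) ->
  (fun m => B (fun x => f_ m x - f x)) @ \oo --> 0%E ->
  exists (u : R -> R[i]) (u_ : nat -> R -> R[i]),
    [/\ unique_solution a b f u, forall m, unique_solution a b (f_ m) (u_ m) &
        cvg_in_H4 u_ u].
Proof.
move=> rsE; have rs4 := size_characteristic_roots rsE.
rewrite /solvable rs4 => -[C C0 CP] Ff Ff_ Fd B0.
have [w [cw wf _]] := CP _ Ff.
have /choice[w_ wP] : forall m, exists w, weak_chain 4 w /\ factored rs w = f_ m.
  by move=> m; have [w' [cw' wf' _]] := CP _ (Ff_ m); exists w'.
have uniq g w' : weak_chain 4 w' -> factored rs w' = g -> unique_solution a b g (w' 0%N).
  move=> cw' wg; split.
    by apply: (chain_solution rsE) => //; apply: aeW => x; rewrite wg.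
  move=> v /(solution_chain rsE)[cv vg].
  apply: (@chain_unique rs (derivatives v) w' g); rewrite ?rs4//.
  by apply: aeW => x; rewrite wg.
exists (w 0%N), (fun m => w_ m 0%N); split.
- exact: uniq.
- by move=> m; have [? ?] := wP m; exact: uniq.
split; [by move=> m; apply: weak_chain_sobolevH (wP m).1|exact: weak_chain_sobolevH cw|].
pose y m := ((C 0%N + C 4%N)%:E * B (fun x => f_ m x - f x)%R)%E.
have y0 : y @ \oo --> 0%E by exact: cvg0_scale.
have bound m : exists2 e, H4norm (fun x => w_ m 0%N x - w 0%N x) = sqrte e & (0 <= e <= y m)%E.
  have [cm fm] := wP m; have cd := weak_chain_sub cm cw.
  have [w' [cw' wf' ew']] := CP _ (Fd m).
  have d0 : ae_equal (w' 0%N) (fun x => w_ m 0%N x - w 0%N x).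
    apply: (@chain_unique rs w' (fun i x => w_ m i x - w i x)
      (fun x => f_ m x - f x)); rewrite ?rs4//.
      by apply: aeW => x; rewrite wf'.
    by apply: aeW => x; rewrite factored_sub fm wf.
  have [Lw' _] := cw'; have [Ld _] := cd.
  have d4 : ae_equal (w' 4%N) (fun x => w_ m 4%N x - w 4%N x).
    have h := weak_chain_weak cd (k := 3) isT; have h' := weak_chain_weak cw' (k := 3) isT.
    apply: cweak_unique h; apply: ae_cweak h' => //.
    - by case: (Ld 0%N isT).
    - by case: (Lw' 4%N isT).
    - exact: aeW.
  exists (cenergy (w' 0%N) + cenergy (w' 4%N))%E.
    rewrite (H4norm_chain cd); congr (sqrte (_ + _)%E); apply/esym/ae_cenergy => //.
    - by case: (Lw' 0%N isT).
    - by case: (Ld 0%N isT).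
    - by case: (Lw' 4%N isT).
    - by case: (Ld 4%N isT).
  rewrite adde_ge0 ?cenergy_ge0//= /y EFinD ge0_muleDl ?lee_fin//.
  by apply: leeD; exact: ew'.
have /choice[e eP] : forall m, exists e,
    H4norm (fun x => w_ m 0%N x - w 0%N x) = sqrte e /\ (0 <= e <= y m)%E.
  by move=> m; have [e' ? ?] := bound m; exists e'.
rewrite (_ : (fun m => _) = (fun m => sqrte (e m))); last first.
  by apply/funext => m; case: (eP m).
apply: cvg0_sqrte; first by move=> n; case: (eP n) => _ /andP[].
by apply: cvg0_squeeze y0 => n; case: (eP n).
Qed.

End convergence.

(** * Admissible data *)

Section data.
Context {R : realType}.
Implicit Types (f g h u v : R -> R[i]).
Local Notation leb := (@lebesgue_measure R).
Local Notation Re := (@complex.Re R).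
Local Notation Im := (@complex.Im R).

Lemma Re_sub (z z' : R[i]) : Re (z - z') = Re z - Re z'.
Proof. by case: z => p q; case: z'. Qed.

Lemma Im_sub (z z' : R[i]) : Im (z - z') = Im z - Im z'.
Proof. by case: z => p q; case: z'. Qed.

Lemma Re_le_normc (z : R[i]) : `|Re z| <= Normc.normc z.
Proof. by case: z => p q /=; rewrite -sqrtr_sqr ler_wsqrtr// lerDl sqr_ge0. Qed.

Lemma Im_le_normc (z : R[i]) : `|Im z| <= Normc.normc z.
Proof. by case: z => p q /=; rewrite -sqrtr_sqr ler_wsqrtr// lerDr sqr_ge0. Qed.

Lemma normc_ge0 (z : R[i]) : 0 <= Normc.normc z.
Proof. exact: le_trans (Re_le_normc z). Qed.

Lemma measurable_normc f : cmeasurable f -> measurable_fun setT (fun x => Normc.normc (f x)).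
Proof.
move=> mf; rewrite (_ : (fun x => _) = Num.sqrt \o (fun x => normsq (f x))).
  apply: measurableT_comp; last exact: cmeasurable_normsq.
  by apply: continuous_measurable_fun; exact: sqrt_continuous.
by apply/funext => x /=; rewrite -normc_sqr sqrtr_sqr ger0_norm// normc_ge0.
Qed.

Lemma integrable_of_L1 (g : R -> R) f : measurable_fun setT g ->
  (forall x, `|g x| <= Normc.normc (f x)) -> in_Lp 1%:E f ->
  leb.-integrable setT (EFin \o g) /\ ((\int[leb]_x `|g x|)%:E <= cLnorm 1%:E f)%E.
Proof.
move=> mg gf [mf f1].
have le1 : (\int[leb]_x `|(g x)%:E| <= cLnorm 1%:E f)%E.
  rewrite /cLnorm Lnorm1; apply: ge0_le_integral => //.
  - by apply: measurableT_comp => //; exact/measurable_EFinP.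
  - by apply: measurableT_comp => //; apply/measurable_EFinP; exact: measurable_normc.
  - by move=> x _; rewrite lee_fin [leRHS]ger0_norm ?normc_ge0.
have ig : leb.-integrable setT (EFin \o g).
  apply/integrableP; split; first exact/measurable_EFinP.
  exact: le_lt_trans le1 f1.
split => //; rewrite fineK//; apply: integrable_fin_num => //.
exact: (integrable_norm ig).
Qed.

Lemma integrable_moment_of_L1 f : cmeasurable f -> in_Lp 1%:E (cmoment f) ->
  [/\ leb.-integrable setT (EFin \o moment (Re \o f)),
      leb.-integrable setT (EFin \o moment (Im \o f)),
      ((\int[leb]_x `|moment (Re \o f) x|)%:E <= cLnorm 1%:E (cmoment f))%E &
      ((\int[leb]_x `|moment (Im \o f) x|)%:E <= cLnorm 1%:E (cmoment f))%E].
Proof.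
move=> [mr mi] xf.
have [||] := @integrable_of_L1 (moment (Re \o f)) (cmoment f) _ _ xf.
- exact: measurable_funM.
- move=> x; apply: le_trans (Re_le_normc _).
  by rewrite /cmoment Re_mul/= mul0r subr0.
have [||] := @integrable_of_L1 (moment (Im \o f)) (cmoment f) _ _ xf => //.
- exact: measurable_funM.
- move=> x; apply: le_trans (Im_le_normc _).
  by rewrite /cmoment Im_mul/= mul0r addr0.
Qed.

(** This converts the two convergences of the data, in L^2 and for the first
    moments in L^1, into the convergence of [weighted_energy]. *)
Lemma weighted_energy_le f : cmeasurable f -> in_Lp 1%:E (cmoment f) ->
  (weighted_energy f <=
   cLnorm 2%:E f ^+ 2 + 2%:E * cLnorm 1%:E (cmoment f) ^+ 2)%E.
Proof.
move=> mf xf; have [_ _ le1 le2] := integrable_moment_of_L1 mf xf.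
have sq (x : R) (y : \bar R) : 0 <= x -> (x%:E <= y)%E -> ((x ^+ 2)%:E <= y ^+ 2)%E.
  move=> x0 xy; rewrite EFin_expe; rewrite lee_sqr ?lee_fin//.
  by rewrite (le_trans _ xy)// lee_fin.
rewrite /weighted_energy cLnorm_sqr leeD2l// EFinD -[2%:E]/((1 + 1)%:E) EFinD.
rewrite ge0_muleDl// mul1e.
by apply: leeD; apply: sq => //; apply: Rintegral_ge0.
Qed.

Lemma cL2_sub u v : cL2 u -> cL2 v -> cL2 (fun x => u x - v x).
Proof.
move=> Lu Lv; have := cL2B 1 Lu Lv; congr cL2.
by apply/funext => x; rewrite mul1r.
Qed.

Lemma inner1 f : inner f (fun=> 1) = 0 ->
  \int[leb]_x Re (f x) = 0 /\ \int[leb]_x Im (f x) = 0.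
Proof.
have E : (fun x => f x * conjc 1) = f.
  by apply/funext => x; rewrite conjc1 mulr1.
by rewrite /inner E /cintegral => -[].
Qed.

(** Means are continuous for [weighted_energy], so the zero mean of the f_m
    passes to the limit. *)
Lemma mean_weighted_bound f : cL2 f -> in_Lp 1%:E (cmoment f) ->
  (((\int[leb]_x Re (f x)) ^+ 2)%:E <= 4%:E * weighted_energy f)%E /\
  (((\int[leb]_x Im (f x)) ^+ 2)%:E <= 4%:E * weighted_energy f)%E.
Proof.
move=> Lf xf; have [mf _] := Lf; have [Lr Li] := (cL2P f).1 Lf.
have [mr mi _ _] := integrable_moment_of_L1 mf xf.
have br := mean_bound Lr mr; have bi := mean_bound Li mi.
have efin (g : R -> R) : L2 g -> energy g \is a fin_num.
  by move=> [_ ?]; rewrite ge0_fin_numE// energy_ge0.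
move: br bi; set E := fine _; set A := \int[leb]_x `|_| => br.
set E' := fine _; set A' := \int[leb]_x `|_| => bi.
have E0 : 0 <= E by rewrite fine_ge0// energy_ge0.
have E'0 : 0 <= E' by rewrite fine_ge0// energy_ge0.
have cE : cenergy f = (E + E')%:E.
  by rewrite cenergyE//; rewrite EFinD !fineK ?efin.
rewrite /weighted_energy cE -EFinD -EFinM !lee_fin -/A -/A'.
have := sqr_ge0 A; have := sqr_ge0 A'.
by split; [apply: (le_trans br)|apply: (le_trans bi)]; lra.
Qed.

Lemma in_L1_sub f g : in_Lp 1%:E f -> in_Lp 1%:E g -> in_Lp 1%:E (fun x => f x - g x).
Proof.
move=> [mf f1] [mg g1].
have md : cmeasurable (fun x => f x - g x).
  have := cmeasurableD mf (cmeasurableZ (-1) mg); congr cmeasurable.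
  by apply/funext => x; rewrite /= mulN1r.
have mn h : cmeasurable h ->
    measurable_fun setT (fun x => `|(Normc.normc (h x))%:E|%E).
  move=> mh; apply: measurableT_comp => //; apply/measurable_EFinP.
  exact: measurable_normc.
split=> //; apply: (@le_lt_trans _ _ (cLnorm 1%:E f + cLnorm 1%:E g)%E); last first.
  exact: lte_add_pinfty.
rewrite /cLnorm !Lnorm1 -ge0_integralD//; [|exact: mn|exact: mn].
apply: ge0_le_integral => //; first exact: mn.
  by apply: emeasurable_funD; exact: mn.
move=> x _; rewrite !gee0_abs ?lee_fin ?normc_ge0//.
by rewrite -(normcN (g x)); exact: le_normcD.
Qed.

Lemma integral_Re_sub f g : cL2 f -> cL2 g ->
  in_Lp 1%:E (cmoment f) -> in_Lp 1%:E (cmoment g) ->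
  \int[leb]_x Re (f x - g x) = \int[leb]_x Re (f x) - \int[leb]_x Re (g x) /\
  \int[leb]_x Im (f x - g x) = \int[leb]_x Im (f x) - \int[leb]_x Im (g x).
Proof.
move=> Lf Lg xf xg; have [mf _] := Lf; have [mg _] := Lg.
have [Lfr Lfi] := (cL2P f).1 Lf; have [Lgr Lgi] := (cL2P g).1 Lg.
have [fr fi _ _] := integrable_moment_of_L1 mf xf.
have [gr gi _ _] := integrable_moment_of_L1 mg xg.
split.
- under eq_Rintegral do rewrite Re_sub.
  by rewrite RintegralB//; exact: integrable_moment.
- under eq_Rintegral do rewrite Im_sub.
  by rewrite RintegralB//; exact: integrable_moment.
Qed.

End data.

Theorem theorem1p2 (R : realType) (a b : R) (f : R -> R[i])
    (f_ : nat -> R -> R[i]) (a_ge0 : 0 <= a) (b_neq0 : b != 0)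
    (f_L2 : forall m, in_Lp 2%:E (f_ m)) (f_cvg : cvg_in_Lp 2%:E f_ f) :
  (0 < a ->
    exists (u : R -> R[i]) (u_ : nat -> R -> R[i]),
      [/\ unique_solution a b f u,
          forall m, unique_solution a b (f_ m) (u_ m) &
          cvg_in_H4 u_ u]) /\
  (a = 0 ->
    (forall m, in_Lp 1%:E (fun x => real_complex R x * f_ m x)) ->
    cvg_in_Lp 1%:E (fun m x => real_complex R x * f_ m x)
                   (fun x => real_complex R x * f x) ->
    (forall m, inner (f_ m) (fun=> 1) = 0) ->
    exists (u : R -> R[i]) (u_ : nat -> R -> R[i]),
      [/\ unique_solution a b f u,
          forall m, unique_solution a b (f_ m) (u_ m) &
          cvg_in_H4 u_ u]).
Proof.
have [_ /in_L2P Lf f0] := f_cvg.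
have Lf_ m : cL2 (f_ m) by exact/in_L2P.
have Ld m : cL2 (fun x => f_ m x - f x) := cL2_sub (Lf_ m) Lf.
split=> [a_gt0|a0 _ [xf_ xf xcvg] mean0].
  have [rs rsE rsRe] := characteristic_roots_gt0 a_gt0 b_neq0.
  apply: (well_posed (F := cL2) (B := cenergy) rsE) => //.
    by rewrite -[rs]cats0; apply: solvable_all => //; exact: solvable_nil.
  under eq_fun do rewrite -cLnorm_sqr.
  exact: cvg0_sqr.
have [rs rsE rsRe] := characteristic_roots_eq0 b_neq0.
have cmB m : cmoment (fun x => f_ m x - f x) = fun x => cmoment (f_ m) x - cmoment f x.
  by apply/funext => x; rewrite /cmoment mulrBr.
have xd m : in_Lp 1%:E (cmoment (fun x => f_ m x - f x)).
  by rewrite cmB; exact: (in_L1_sub (xf_ m) xf).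
have W0 : (fun m => weighted_energy (fun x => f_ m x - f x)) @ \oo --> 0%E.
  apply: (@cvg0_squeeze _ _ (fun m => cLnorm 2%:E (fun x => (f_ m x - f x)%R) ^+ 2 +
    2%:E * cLnorm 1%:E (fun x => (cmoment (f_ m) x - cmoment f x)%R) ^+ 2)%E).
    move=> m; rewrite -cmB weighted_energy_le//; last by case: (Ld m).
    by rewrite adde_ge0// ?cenergy_ge0// lee_fin addr_ge0// sqr_ge0.
  have := cvgeD (isT : (0 : \bar R) +? 0)%E (cvg0_sqr f0)
    (@cvg0_scale R 2 _ (cvg0_sqr xcvg)).
  rewrite adde0; exact.
(* a constant bounded by a null sequence vanishes *)
have null (c : R) : (forall m, ((c ^+ 2)%:E <=
    4%:E * weighted_energy (fun x => (f_ m x - f x)%R))%E) -> c = 0.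
  move=> cW; apply/eqP; rewrite -sqrf_eq0 -eqe; apply/eqP.
  have c0 : (fun _ : nat => (c ^+ 2)%:E) @ \oo --> 0%E.
    apply: cvg0_squeeze (@cvg0_scale R 4 _ W0) => m.
    by rewrite lee_fin sqr_ge0 cW.
  exact: (cvg_unique _ (cvg_cst _) c0).
have bal_ m : balanced (f_ m).
  have [mf_ _] := Lf_ m; have [mr mi _ _] := integrable_moment_of_L1 mf_ (xf_ m).
  by have [? ?] := inner1 (mean0 m); split.
have meanB m : (\int[lebesgue_measure]_x complex.Re (f_ m x - f x) =
      - \int[lebesgue_measure]_x complex.Re (f x)) /\
    (\int[lebesgue_measure]_x complex.Im (f_ m x - f x) =
      - \int[lebesgue_measure]_x complex.Im (f x)).
  have [? ? ? fr0 fi0] := bal_ m.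
  have [-> ->] := integral_Re_sub (Lf_ m) Lf (xf_ m) xf.
  by rewrite fr0 fi0 !sub0r.
have bal : balanced f.
  have [mf _] := Lf; have [mr mi _ _] := integrable_moment_of_L1 mf xf.
  split => //; apply: null => m.
  - by have [+ _] := mean_weighted_bound (Ld m) (xd m); rewrite (meanB m).1 sqrrN.
  - by have [_ +] := mean_weighted_bound (Ld m) (xd m); rewrite (meanB m).2 sqrrN.
have bald m : balanced (fun x => f_ m x - f x).
  have [md _] := Ld m; have [mr mi _ _] := integrable_moment_of_L1 md (xd m).
  have [? ? ? fr0 fi0] := bal.
  by split; rewrite ?(meanB m).1 ?(meanB m).2 ?fr0 ?fi0 ?oppr0.
rewrite a0; apply: (well_posed (F := balanced) (B := weighted_energy) rsE) => //.
by apply: solvable_all => //; exact: solvable_zero.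
Qed.
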